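(* There exist constants $C>0$ and $c>0$ such that for every integer $n\ge 1$, $$\mathrm{Fav}(\mathcal{G}_n)\le \frac{C}{n^{c}}.$$
   Context: For $\theta\in[0,\pi]$, $\mathrm{proj}_\theta$ denotes orthogonal projection of $\mathbb{C}$ onto the line through the origin making angle $\theta$ with the real axis, and $|\cdot|$ of a subset of a line is its one-dimensional Lebesgue measure. The Favard length of $E\subset\mathbb{C}$ is $$\mathrm{Fav}(E)=\frac1\pi\int_0^\pi|\mathrm{proj}_\theta(E)|\,d\theta.$$ Let $B(z_0,r)=\{z\in\mathbb{C}:|z-z_0|<r\}$. For $\alpha=(\alpha_1,\dots,\alpha_n)\in\{-1,0,1\}^n$ put $$z_\alpha=\sum_{k=1}^n\left(\tfrac13\right)^k e^{i\pi\left[\frac12+\frac23\alpha_k\right]},\qquad \mathcal{G}_n=\bigcup_{\alpha\in\{-1,0,1\}^n}B(z_\alpha,3^{-n}).$$ *)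

(* Defs.v *)
From HB Require Import structures.
From mathcomp Require Import all_boot all_order all_algebra complex.
From mathcomp Require Import all_classical all_reals all_analysis.

Set Implicit Arguments.
Unset Strict Implicit.
Unset Printing Implicit Defensive.

Import Order.TTheory GRing.Theory Num.Theory.
Import numFieldNormedType.Exports.

Local Open Scope classical_set_scope.
Local Open Scope ring_scope.
Local Open Scope complex_scope.

Section Favard.
Context {R : realType}.

Definition expi (t : R) : R[i] := cos t +i* sin t.

Definition dotc (z w : R[i]) : R :=
  complex.Re z * complex.Re w + complex.Im z * complex.Im w.

(* Orthogonal projection onto the line spanned by the unit vector
   [expi theta]; its values are points of that line. *)
Definition proj_line (theta : R) (z : R[i]) : R[i] :=
  (dotc z (expi theta))%:C * expi theta.

(* One-dimensional Lebesgue measure on the line [{t * expi theta | t : R}],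
   read off through the isometric parametrization [t |-> t * expi theta];
   meaningful for [A] contained in that line. *)
Definition line_measure (theta : R) (A : set R[i]) : \bar R :=
  lebesgue_measure [set t : R | A (t%:C * expi theta)].

(* Extended-real valued, so that no integrability is presupposed. *)
Definition favard (E : set R[i]) : \bar R :=
  ((pi^-1)%:E *
   \int[lebesgue_measure]_(theta in `[0%R, pi])
     line_measure theta (proj_line theta @` E))%E.

(* The norm on [R[i]] is [R[i]]-valued, hence the injection of [r]. *)
Definition discc (z0 : R[i]) (r : R) : set R[i] :=
  [set z | `|z - z0| < r%:C].

(* [alpha k] with [k : 'I_n] stands for the coordinate of index [k.+1]. *)
Definition gasket_index (n : nat) : set ('I_n -> int) :=
  [set alpha | forall k, alpha k \in [:: -1; 0; 1]].

Definition gasket_center (n : nat) (alpha : 'I_n -> int) : R[i] :=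
  \sum_(k < n) ((3^-1 : R) ^+ k.+1)%:C *
    expi (pi * (2^-1 + 2 / 3 * (alpha k)%:~R)).

Definition gasket (n : nat) : set R[i] :=
  \bigcup_(alpha in @gasket_index n) discc (gasket_center alpha) (3 ^- n).

End Favard.

(* Main.v *)
Require Import Defs.
From mathcomp Require Import all_boot all_order all_algebra complex.
From mathcomp Require Import all_classical all_reals all_analysis measurable_realfun.
From mathcomp Require Import ring lra zify.

Import Order.TTheory GRing.Theory Num.Theory.
Import numFieldNormedType.Exports.
Local Open Scope ring_scope.

Set Implicit Arguments.
Unset Strict Implicit.
Unset Printing Implicit Defensive.

(** The projection of the gasket to the line at angle th is an interval
    neighbourhood of the points [pos (dir th) w], where [w] runs over the words
    of length [n] in three letters and the digits [dir th a] are three numbers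
    in [-1, 1].  The shadow of generation [n] is the union of the intervals of
    radius 3^-n around these 3^n points; it can only be short when many points
    lie close together.  Closeness is measured by the pair energy
    E_n = 3^-n * [near_pairs n], where [near_pairs n] counts the pairs of words
    whose points are within 3^-n.

    Fix a large K.  Three facts are combined.

    - Self-similarity, energy side ([near_pairs_bound]).  A word with more than
      K neighbours has a shortest prefix with that property, and this prefix has
      at most 3K neighbours.  Summing over the level of the prefix bounds E_n by
      K plus the density of such prefixes times earlier energies.  So if words
      with more than K neighbours are rare at every level up to N, then
      E_n <= 2K for all n <= N.

    - Self-similarity, length side ([coverable_of_rich]).  If such crowded words
      are not rare at some level k, cut a long word into blocks of length k.
      Whenever a block is crowded, the corresponding pieces overlap K-fold;
      words without any crowded block have exponentially small density.  Hence
      the shadow of a polynomially later generation has length O(1/K).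

    - Fourier analysis ([energy_dichotomy]).  The normalized squared modulus
      [power n] of the characteristic function of the points is, at t, the
      product of the values [symbol (3^-k t)] for 1 <= k <= n.  Its integral
      over [0, 3^n] is at most a multiple of E_n, by comparison with the
      triangle weight.  Conversely, for n = n' + m, the integral of [power n']
      over [3^n', 3^n] is at least 3^m / 2 minus a multiple of E_n', because the
      diagonal pairs alone contribute 3^m / 2.  If the remaining m factors are
      bounded below, each of the B disjoint frequency blocks of length m
      contributes a fixed amount to the integral of [power (m * B)], so that
      E_n <= 2K for all n <= m * B is impossible once B is large.

    The lower bound for the m factors is where the three-fold structure enters.
    A sum of three unit complex numbers vanishes only if they are, up to a
    common rotation, the cube roots of unity; tripling all phases then makes
    them coincide.  So right after a small value of [symbol] comes a run of
    values close to 1, whose length is proportional to the logarithm of the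
    small value, and the product over m consecutive scales is at least an
    exponential in -m times the smallest single factor ([power_lower]).  It
    remains to exclude angles where a single factor is very small on [0, 3^m].
    Such a small value is a near coincidence between integers k, l and the two
    digit differences, which confines the angle to a sublevel set of a sinusoid;
    there are O(9^m) such sets, and taking the threshold to be a high power of
    3^-m makes their total length at most 3^-m ([coverable_bad_angles]).

    With K = 3^s, m = s + 5, and with B, N and the final generation being fixed
    powers of 3^s, both the good and the bad angles contribute O(3^-s) to the
    Favard length of a generation 3^(34 s + 217), which is a power law.

    Lengths of shadows are bounded through explicit finite families of
    intervals ([coverable]), for which scaling and translation are immediate;
    they become bounds on Lebesgue measure only at the very end. *)

(** * Words and projected centres *)

Section Words.
Context {R : realType} (c : 'I_3 -> R).

Fixpoint words (n : nat) : seq (seq 'I_3) :=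
  if n is m.+1 then [seq a :: w | a <- enum 'I_3, w <- words m] else [:: [::]].

Fixpoint pos (w : seq 'I_3) : R := if w is a :: w' then (c a + pos w') / 3 else 0.

Lemma size_words n w : w \in words n -> size w = n.
Proof.
elim: n w => [|n IH] w /=; first by rewrite inE => /eqP ->.
by case/allpairsP => -[a v] /= [_ /IH <- ->].
Qed.

Lemma sum_words_cat (V : nmodType) k n (G : seq 'I_3 -> V) :
  \sum_(w <- words (k + n)) G w =
  \sum_(u <- words k) \sum_(v <- words n) G (u ++ v).
Proof.
elim: k G => [|k IH] G; first by rewrite add0n big_seq1.
rewrite addSn /= !big_allpairs_dep /=; apply: eq_bigr => a _.
by rewrite (IH (fun w => G (a :: w))).
Qed.

Lemma sum_words1 (G : seq 'I_3 -> R) :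
  \sum_(w <- words 1) G w = \sum_(a < 3) G [:: a].
Proof.
rewrite [words 1]/words big_allpairs_dep big_enum /=; apply: eq_bigr => a _.
by rewrite big_seq1.
Qed.

Lemma words_cat k n w : w \in words (k + n) ->
  exists u v, [/\ u \in words k, v \in words n & w = u ++ v].
Proof.
elim: k w => [|k IH] w; first by exists [::], w; rewrite inE.
rewrite addSn /= => /allpairsP[[a v]] /= [ha /IH[u [v' [hu hv ->]]] ->].
exists (a :: u), v'; split => //; apply/allpairsP; by exists (a, u).
Qed.

Lemma mem_words1 a : [:: a] \in words 1.
Proof. by apply/allpairsP; exists (a, [::]); rewrite mem_enum inE. Qed.

Lemma sum_words_const n (x : R) : \sum_(w <- words n) x = 3 ^+ n * x.
Proof.
elim: n => [|n IH]; first by rewrite big_seq1 mul1r.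
rewrite /= big_allpairs_dep /= big_enum /= (eq_bigr (fun=> 3 ^+ n * x)) //.
by rewrite sumr_const card_ord -[LHS]mulr_natl exprS mulrA.
Qed.

Lemma pos_cat u v : pos (u ++ v) = pos u + 3 ^- size u * pos v.
Proof.
elim: u => [|a u IH] /=; first by rewrite expr0 invr1 mul1r add0r.
by rewrite IH exprS invfM; field; rewrite expf_neq0.
Qed.

Hypothesis c_le1 : forall a, `|c a| <= 1.

Lemma pos_bound w : `|pos w| <= (1 - 3 ^- size w) / 2.
Proof.
elim: w => [|a w IH] /=; first by rewrite normr0 expr0 invr1 subrr mul0r.
rewrite normrM (ger0_norm (_ : 0 <= 3^-1)) ?invr_ge0// exprS invfM.
have := ler_normD (c a) (pos w); have := c_le1 a.
move: IH; set x := `|c a + _|; set y := 3 ^- _; set z := `|pos w|; set t := `|c a|.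
lra.
Qed.

Definition near n u v := `|pos u - pos v| <= 3 ^- n.

Definition neighbours n u : R := \sum_(v <- words n) (near n u v)%:R.

Definition near_pairs n : R := \sum_(u <- words n) neighbours n u.

Lemma pow3_gt0 n : 0 < 3 ^- n :> R.
Proof. by rewrite invr_gt0 exprn_gt0. Qed.

(** The points of the extensions of a word of length [k] by [n] letters stay
    within (3^-k - 3^-(k+n)) / 2 of its own point, so closeness at a fine scale
    is inherited by prefixes at their coarser scale. *)
Lemma near_prefix k n u v u' v' : u \in words k -> u' \in words k ->
  v \in words n -> v' \in words n ->
  near (k + n) (u ++ v) (u' ++ v') -> near k u u'.
Proof.
move=> /size_words su /size_words su' /size_words sv /size_words sv'.
rewrite /near !pos_cat su su' => h.
have := pos_bound v; have := pos_bound v'; rewrite sv sv' => b1 b2.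
have -> : pos u - pos u' = (pos u + 3 ^- k * pos v - (pos u' + 3 ^- k * pos v'))
   - 3 ^- k * (pos v - pos v') by ring.
apply: (le_trans (ler_normB _ _)).
rewrite normrM (gtr0_norm (pow3_gt0 k)).
move: h; rewrite exprD invfM; set X := `|_|.
have := ler_normB (pos v) (pos v'); have := pow3_gt0 k; have := pow3_gt0 n.
nra.
Qed.

Lemma neighbours_ge0 n u : 0 <= neighbours n u.
Proof. by apply: sumr_ge0 => v _; rewrite ler0n. Qed.

(** One more letter multiplies the number of neighbours by at most three, since
    the neighbours of an extension extend neighbours.  Hence the count is at
    most 3K when it first exceeds a threshold K. *)
Lemma neighbours_step k u a : u \in words k ->
  neighbours (k + 1) (u ++ [:: a]) <= 3 * neighbours k u.
Proof.
move=> hu; rewrite /neighbours sum_words_cat mulr_sumr big_seq [leRHS]big_seq.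
apply: ler_sum => v hv; rewrite sum_words1.
have -> : 3 * (near k u v)%:R = \sum_(i < 3) (near k u v)%:R :> R.
  by rewrite sumr_const card_ord -[RHS]mulr_natl.
apply: ler_sum => b _; rewrite ler_nat.
case: (boolP (near (k + 1) _ _)) => // h.
by rewrite (near_prefix hu hv _ _ h) // mem_words1.
Qed.

End Words.

(** * Counting close pairs through cells *)

Section Cells.
Context {R : realType}.

Lemma count_window (a : R) (d B : nat) :
  \sum_(j < B) (`|j%:R - a| < d%:R :> R)%:R <= (2 * d)%:R :> R.
Proof.
rewrite -natr_sum ler_nat; set f := fun B => (\sum_(j < B) (`|j%:R - a| < d%:R :> R)%R)%N.
(* The second component bounds the count by the room between the left end of
   the window and B; it is what forbids a (2 d + 1)-st integer. *)
suff : (f B <= 2 * d)%N /\ (f B = 0%N \/ (f B)%:R < B%:R - a + d%:R :> R) by case.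
elim: B => [|B [IH1 IH2]]; first by rewrite /f big_ord0; split => //; left.
have -> : f B.+1 = (f B + (`|B%:R - a| < d%:R :> R)%R)%N by rewrite /f big_ord_recr.
have -> : B.+1%:R - a + d%:R = B%:R - a + d%:R + 1 :> R by rewrite -natr1; ring.
move: (f B) IH1 IH2 => x IH1 IH2 {f}.
case: ltP => [|_]; last first.
  rewrite addn0; split => //; case: IH2 => [|h]; [by left|right; lra].
rewrite ltr_norml => /andP[h1 h2].
case: IH2 => [->|h].
  split; last by right; rewrite add0n /=; lra.
  rewrite add0n; case: d h1 h2 {IH1} => [|d] //; lra.
split; last by right; rewrite natrD /=; lra.
suff : (x < 2 * d)%N by rewrite addn1.
by rewrite -(ltr_nat R) natrM; lra.
Qed.

(** Grouping by the value of [kappa] turns both sides into quadratic forms in the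
    cell counts; the bound is then Schur's test, i.e. 2ab <= a^2 + b^2 together
    with the bounds on row and column sums. *)
Lemma schur_test (T : Type) (s : seq T) (kappa : T -> nat) (B : nat)
    (G : nat -> nat -> R) (M : R) :
  (forall t, kappa t < B)%N ->
  (forall i j, 0 <= G i j) ->
  (forall i, \sum_(j < B) G i j <= M) ->
  (forall j, \sum_(i < B) G i j <= M) ->
  \sum_(u <- s) \sum_(v <- s) G (kappa u) (kappa v) <=
  M * \sum_(u <- s) \sum_(v <- s) (kappa u == kappa v)%:R.
Proof.
move=> hB G0 Gr Gc; pose cnt (i : nat) : R := \sum_(u <- s) (kappa u == i)%:R.
have sumE (F : nat -> R) : \sum_(u <- s) F (kappa u) = \sum_(i < B) cnt i * F i.
  rewrite (eq_bigr (fun u => \sum_(i < B) (kappa u == i)%:R * F i)); last first.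
    move=> u _; rewrite (bigD1 (Ordinal (hB u))) //= eqxx mul1r big1 ?addr0 // => i.
    by rewrite -val_eqE /= eq_sym => /negbTE ->; rewrite mul0r.
  by rewrite exchange_big /=; apply: eq_bigr => i _; rewrite -mulr_suml.
have -> : \sum_(u <- s) \sum_(v <- s) G (kappa u) (kappa v) =
    \sum_(i < B) \sum_(j < B) cnt i * cnt j * G i j.
  rewrite (eq_bigr (fun u => \sum_(j < B) cnt j * G (kappa u) j)); last first.
    by move=> u _; rewrite (sumE (fun j => G (kappa u) j)).
  rewrite (sumE (fun i => \sum_(j < B) cnt j * G i j)); apply: eq_bigr => i _.
  by rewrite mulr_sumr; apply: eq_bigr => j _; rewrite mulrA.
have -> : \sum_(u <- s) \sum_(v <- s) (kappa u == kappa v)%:R =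
    \sum_(i < B) cnt i ^+ 2.
  rewrite (eq_bigr (fun u => cnt (kappa u))); last first.
    by move=> u _; apply: eq_bigr => v _; rewrite eq_sym.
  by rewrite sumE; apply: eq_bigr => i _; rewrite expr2.
apply: (@le_trans _ _ (\sum_(i < B) \sum_(j < B)
    (cnt i ^+ 2 * G i j / 2 + cnt j ^+ 2 * G i j / 2))).
  apply: ler_sum => i _; apply: ler_sum => j _.
  have := sqr_ge0 (cnt i - cnt j); have := G0 i j; nra.
under eq_bigr do rewrite big_split /=.
rewrite big_split /= [X in _ + X]exchange_big /= -big_split /= mulr_sumr.
apply: ler_sum => i _; rewrite -!mulr_suml -!mulr_sumr.
have := Gr i; have := Gc i; have := sqr_ge0 (cnt i); nra.
Qed.

End Cells.

Section Shift.
Context {R : realType} (c : 'I_3 -> R).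
Hypothesis c_le1 : forall a, `|c a| <= 1.

(** The shift by 1 makes the argument nonnegative, so that cells are natural
    numbers below 2 * 3^n. *)
Definition cell n (w : seq 'I_3) := Num.truncn (3 ^+ n * (pos c w + 1)).

Lemma pos_half w : `|pos c w| <= 1 / 2.
Proof. by have := pos_bound c_le1 w; have := @pow3_gt0 R (size w); lra. Qed.

Lemma cell_itv n w :
  (cell n w)%:R <= 3 ^+ n * (pos c w + 1) < (cell n w)%:R + 1.
Proof.
have := pos_half w; rewrite ler_norml => /andP[h1 h2].
rewrite natr1; apply: truncn_itv; apply: mulr_ge0; rewrite ?exprn_ge0 //; lra.
Qed.

Lemma cell_lt n w : (cell n w < 2 * 3 ^ n)%N.
Proof.
have /andP[h _] := cell_itv n w; rewrite -(ltr_nat R); apply: (le_lt_trans h).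
have := pos_half w; rewrite ler_norml => /andP[h1 h2].
rewrite natrM natrX mulrC ltr_pM2r ?exprn_gt0 //; lra.
Qed.

Lemma nearE n u v : near c n u v = (`|3 ^+ n * pos c u - 3 ^+ n * pos c v| <= 1).
Proof.
have h : 0 < 3 ^+ n :> R by rewrite exprn_gt0.
by rewrite /near -mulrBr normrM gtr0_norm // mulrC -ler_pdivlMr // mul1r.
Qed.

Lemma cell_near n u v : cell n u = cell n v -> near c n u v.
Proof.
move=> e; have /andP[] := cell_itv n u; have /andP[] := cell_itv n v.
by rewrite e nearE ler_norml => *; lra.
Qed.

Lemma sum_cells_le n :
  \sum_(u <- words n) \sum_(v <- words n) (cell n u == cell n v)%:R <=
  near_pairs c n.
Proof.
apply: ler_sum => u _; apply: ler_sum => v _; rewrite ler_nat.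
by case: eqP => // /cell_near ->.
Qed.

(** Translating one of the two copies of a finite set cannot increase the number
    of coincidences by more than a constant: positions in the same cell maximize
    the correlation, and a translate of the tolerance window meets at most four
    cells. *)
Lemma shifted_pairs_le n (x : R) :
  \sum_(u <- words n) \sum_(v <- words n)
    (`|pos c u - pos c v + x| <= 3 ^- n :> R)%:R <= 4 * near_pairs c n.
Proof.
pose G (i j : nat) : R := (`|i%:R - j%:R + 3 ^+ n * x| < 2 :> R)%:R.
apply: (@le_trans _ _ (\sum_(u <- words n) \sum_(v <- words n)
    G (cell n u) (cell n v))).
  apply: ler_sum => u _; apply: ler_sum => v _; rewrite ler_nat.
  case: (boolP (_ <= 3 ^- n)) => // h; rewrite lt0b.
  have /andP[a1 a2] := cell_itv n u; have /andP[b1 b2] := cell_itv n v.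
  have p : 0 < 3 ^+ n :> R by rewrite exprn_gt0.
  move: h; rewrite -[3 ^- n]mul1r ler_pdivlMr // -{1}(gtr0_norm p) -normrM.
  rewrite ler_norml => /andP[h1 h2]; rewrite ltr_norml; apply/andP; split; lra.
apply: (le_trans (schur_test _ (cell_lt n) _ _ _)).
- by move=> i j; rewrite ler0n.
- move=> i; rewrite (eq_bigr (fun j : 'I__ => (`|j%:R - (i%:R + 3 ^+ n * x)| < 2%N%:R :> R)%:R)).
    exact: (count_window _ 2).
  by move=> j _; rewrite /G -normrN; congr (nat_of_bool (`|_| < _))%:R; ring.
- move=> j; rewrite (eq_bigr (fun i : 'I__ => (`|i%:R - (j%:R - 3 ^+ n * x)| < 2%N%:R :> R)%:R)).
    exact: (count_window _ 2).
  by move=> i _; rewrite /G; congr (nat_of_bool (`|_| < _))%:R; ring.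
by rewrite ler_wpM2l // sum_cells_le.
Qed.

End Shift.

(** * The pair energy is bounded unless some scale is crowded *)

Section Energy.
Context {R : realType} (c : 'I_3 -> R).
Hypothesis c_le1 : forall a, `|c a| <= 1.

Definition rich_count (K : R) n : R := \sum_(u <- words n) (K < neighbours c n u)%R%:R.

Lemma take_words k n w : (k <= n)%N -> w \in words n -> take k w \in words k.
Proof.
move=> kn; rewrite -{1}(subnKC kn) => /words_cat[u [v [hu hv ->]]].
by rewrite -{1}(size_words hu) take_size_cat.
Qed.

Lemma neighbours_take_step k n w : (k < n)%N -> w \in words n ->
  neighbours c k.+1 (take k.+1 w) <= 3 * neighbours c k (take k w).
Proof.
move=> kn wn; have := take_words kn wn; rewrite -(addn1 k).
case/words_cat=> u [v [hu hv e]]; have sv := size_words hv.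
have su := size_words hu.
have -> : take k w = u.
  by rewrite -(take_takel w (leq_addr 1 k)) e -[in take k _]su take_size_cat.
rewrite e; case: v sv {e hv} => [|a []] // _.
exact: neighbours_step.
Qed.

(** If [w] itself has more than [K] neighbours, the shortest prefix with more than
    [K] neighbours has at most [3 * K] of them; its term in the sum is the whole
    of [neighbours c n w]. *)
Lemma neighbours_first_rich (K : R) n w : 1 <= K -> w \in words n ->
  neighbours c n w <= K + \sum_(k < n)
    (K < neighbours c k.+1 (take k.+1 w) <= 3 * K)%R%:R * neighbours c n w.
Proof.
move=> K1 wn; have S0 : 0 <= \sum_(k < n)
    (K < neighbours c k.+1 (take k.+1 w) <= 3 * K)%R%:R * neighbours c n w.
  by apply: sumr_ge0 => k _; rewrite mulr_ge0 ?ler0n ?neighbours_ge0.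
case: (leP (neighbours c n w) K) => [h|h]; first by lra.
pose P k := K < neighbours c k (take k w).
have exP : exists k, P k by exists n; rewrite /P -{2}(size_words wn) take_size.
case: (ex_minnP exP) => -[|k] Pk kmin.
  (* The empty word has a single neighbour, itself, and K is at least 1. *)
  by move: Pk; rewrite /P take0 /neighbours big_seq1 /near subrr normr0 expr0 invr1 ler01 /=; lra.
have kn : (k < n)%N by apply: kmin; rewrite /P -{2}(size_words wn) take_size.
have hk : neighbours c k (take k w) <= K.
  by rewrite leNgt; apply/negP => /kmin; rewrite ltnn.
rewrite (bigD1 (Ordinal kn)) //= (_ : (_ < _ <= _) = true); last first.
  apply/andP; split; first exact: Pk.
  by have := neighbours_take_step kn wn; lra.
rewrite mul1r; set S := \sum_(_ < _ | _) _.
have : 0 <= S by apply: sumr_ge0 => i _; rewrite mulr_ge0 ?ler0n ?neighbours_ge0.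
lra.
Qed.

(** Close pairs of words of length k + j have close prefixes, and once the
    prefixes are fixed the suffixes form a close pair up to a translation. *)
Lemma neighbours_children_le k j u : u \in words k ->
  \sum_(v <- words j) neighbours c (k + j) (u ++ v) <= neighbours c k u * (4 * near_pairs c j).
Proof.
move=> hu; rewrite /neighbours.
under eq_bigr do rewrite sum_words_cat.
rewrite exchange_big /= mulr_suml big_seq [leRHS]big_seq.
apply: ler_sum => u' hu'.
case: (boolP (near c k u u')) => h; last first.
  rewrite mul0r big_seq big1 // => v hv; rewrite big_seq big1 // => v' hv'.
  case: (boolP (near _ _ _ _)) => // /(near_prefix c_le1 hu hu' hv hv').
  by rewrite (negbTE h).
rewrite mul1r; apply: le_trans (shifted_pairs_le c_le1 j (3 ^+ k * (pos c u - pos c u'))).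
apply: ler_sum => v _; apply: ler_sum => v' _; rewrite ler_nat.
case: (boolP (near _ _ _ _)) => // {}h; rewrite lt0b.
move: h; rewrite /near !pos_cat (size_words hu) (size_words hu') exprD invfM.
have p : 0 < 3 ^+ k :> R by rewrite exprn_gt0.
have -> : pos c u + 3 ^- k * pos c v - (pos c u' + 3 ^- k * pos c v') =
  3 ^- k * (pos c v - pos c v' + 3 ^+ k * (pos c u - pos c u')).
  by field; rewrite gt_eqF.
by rewrite normrM gtr0_norm ?invr_gt0 // ler_pM2l ?invr_gt0.
Qed.

Lemma near_pairs_rec (K : R) n : 1 <= K ->
  near_pairs c n <= K * 3 ^+ n + \sum_(k < n)
    rich_count K k.+1 * (12 * K * near_pairs c (n - k.+1)).
Proof.
move=> K1; rewrite {1}/near_pairs.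
apply: (@le_trans _ _ (\sum_(w <- words n) (K + \sum_(k < n)
    (K < neighbours c k.+1 (take k.+1 w) <= 3 * K)%R%:R * neighbours c n w))).
  by rewrite big_seq [leRHS]big_seq; apply: ler_sum => w hw; exact: neighbours_first_rich.
rewrite big_split /= sum_words_const mulrC lerD2l exchange_big /=.
apply: ler_sum => -[k kn] _ /=.
rewrite -{1 2}(subnKC kn) sum_words_cat /rich_count mulr_suml.
rewrite big_seq [leRHS]big_seq; apply: ler_sum => u hu.
rewrite (eq_bigr (fun v => (K < neighbours c k.+1 u <= 3 * K)%R%:R *
   neighbours c (k.+1 + (n - k.+1)) (u ++ v))); last first.
  by move=> v _; rewrite take_size_cat ?(size_words hu).
rewrite -mulr_sumr; case: (boolP (K < neighbours c k.+1 u)) => //= h; last by rewrite !mul0r.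
case: (boolP (neighbours c k.+1 u <= 3 * K)) => h'.
  rewrite !mul1r; apply: (le_trans (neighbours_children_le _ hu)).
  have : 0 <= near_pairs c (n - k.+1) by apply: sumr_ge0 => v _; exact: neighbours_ge0.
  nra.
rewrite mul0r mul1r mulr_ge0 ?sumr_ge0 // => [|v _]; [lra|exact: neighbours_ge0].
Qed.

(** The recursion [near_pairs_rec] is closed under the bound 2K as soon as the
    total density of crowded prefixes over the N levels is at most 1 / (24 K). *)
Lemma near_pairs_bound (K eta : R) N : 1 <= K -> 0 <= eta ->
  24 * K * N%:R * eta <= 1 ->
  (forall k, (1 <= k <= N)%N -> rich_count K k <= 3 ^+ k * eta) ->
  forall n, (n <= N)%N -> near_pairs c n <= 2 * K * 3 ^+ n.
Proof.
move=> K1 eta0 small hr; elim/ltn_ind => n IH nN.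
apply: (le_trans (near_pairs_rec n K1)).
apply: (@le_trans _ _ (K * 3 ^+ n + \sum_(k < n) 3 ^+ n * (24 * K ^+ 2 * eta))).
  rewrite lerD2l; apply: ler_sum => -[k kn] _ /=.
  have h1 : rich_count K k.+1 <= 3 ^+ k.+1 * eta.
    by apply: hr; rewrite /= (leq_trans kn).
  have h2 : near_pairs c (n - k.+1) <= 2 * K * 3 ^+ (n - k.+1).
    by apply: IH; rewrite ?ltn_subrL //= ?(leq_ltn_trans _ kn) // (leq_trans (leq_subr _ _)).
  have -> : 3 ^+ n * (24 * K ^+ 2 * eta) =
     3 ^+ k.+1 * eta * (12 * K * (2 * K * 3 ^+ (n - k.+1))).
    by rewrite -{1}(subnKC kn) exprD; ring.
  have r0 : 0 <= rich_count K k.+1 by apply: sumr_ge0 => v _; rewrite ler0n.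
  apply: ler_pM => //; last by rewrite ler_wpM2l //; lra.
  apply: mulr_ge0; first lra.
  by apply: sumr_ge0 => v _; exact: neighbours_ge0.
rewrite sumr_const card_ord -[X in _ + X]mulr_natl.
have h : n%:R * eta * (24 * K) <= 1.
  have nN' : n%:R <= N%:R :> R by rewrite ler_nat.
  have h : 0 <= eta * (24 * K) by rewrite mulr_ge0 //; lra.
  by have := ler_wpM2r h nN'; lra.
have p : 0 < 3 ^+ n * K by rewrite mulr_gt0 ?exprn_gt0 //; lra.
have -> : n%:R * (3 ^+ n * (24 * K ^+ 2 * eta)) = 3 ^+ n * K * (n%:R * eta * (24 * K)) by ring.
nra.
Qed.

End Energy.

(** * A crowded scale makes the shadow short *)

Section Cover.
Context {R : realType} (c : 'I_3 -> R).
Hypothesis c_le1 : forall a, `|c a| <= 1.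

(** A bound on outer measure whose behaviour under affine maps and finite unions is
    seen directly on the lists of intervals, given by centre and radius. *)
Definition coverable (A : R -> Prop) (l : R) := exists s : seq (R * R),
  [/\ forall p, p \in s -> 0 <= p.2,
      forall x, A x -> exists2 p, p \in s & `|x - p.1| < p.2 &
      \sum_(p <- s) 2 * p.2 <= l].

Definition shadow n (x : R) := exists2 w, w \in words n & `|x - pos c w| < 3 ^- n.

Lemma shadow_prefix k n x u v : u \in words k -> v \in words n ->
  `|x - pos c (u ++ v)| < 3 ^- (k + n) -> `|x - pos c u| < 3 ^- k.
Proof.
move=> /size_words su /size_words sv; rewrite pos_cat su exprD invfM => h.
have hv := pos_bound c_le1 v; rewrite sv in hv.
have -> : x - pos c u = (x - (pos c u + 3 ^- k * pos c v)) + 3 ^- k * pos c v by ring.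
apply: (le_lt_trans (ler_normD _ _)).
rewrite normrM (gtr0_norm (pow3_gt0 k)).
have n1 : 3 ^- n <= 1 :> R by rewrite invf_le1 ?exprn_gt0 // exprn_ege1 // ler1n.
move: h hv n1 (@pow3_gt0 R k); set X := `|_|; set V := `|_|.
move: (3 ^- n) (3 ^- k) => a b; nra.
Qed.

Lemma shadow_mono k n x : (k <= n)%N -> shadow n x -> shadow k x.
Proof.
move=> kn [w]; rewrite -{1 2}(subnKC kn) => /words_cat[u [v [hu hv ->]]] h.
by exists u => //; exact: shadow_prefix h.
Qed.

Lemma coverable_le A B (l l' : R) : (forall x, B x -> A x) -> l <= l' ->
  coverable A l -> coverable B l'.
Proof.
move=> BA ll [s [s0 sA sl]]; exists s; split => // [x /BA /sA //|].
exact: le_trans sl ll.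
Qed.

(** Words next to a crowded one, rather than crowded words, are removed: every one
    of the more than K words around a crowded word is again of this kind, so that
    each removed stack is paid for by K removed words. *)
Definition near_rich (K : R) k u :=
  has (fun v => (K < neighbours c k v) && near c k u v) (words k).

Definition near_rich_count (K : R) k : R :=
  \sum_(u <- words k) (near_rich K k u)%:R.

Lemma near_rich_refl K k u : u \in words k -> K < neighbours c k u -> near_rich K k u.
Proof.
by move=> hu h; apply/hasP; exists u => //; rewrite h /near subrr normr0 invr_ge0 exprn_ge0.
Qed.

Definition hit_cell (K : R) k i :=
  has (fun u => near_rich K k u && (cell c k u == i)) (words k).

(** A cell containing a removed word lies near a crowded word, whose more than K
    neighbours are all removed words located in nearby cells; each of these is
    charged by at most six cells. *)
Lemma hit_cells_le (K : R) k B : 0 <= K ->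
  K * \sum_(i < B) (hit_cell K k i)%:R <= 6 * near_rich_count K k.
Proof.
move=> K0; rewrite mulr_sumr.
pose z u : R := 3 ^+ k * (pos c u + 1).
apply: (@le_trans _ _ (\sum_(i < B) \sum_(g <- words k)
   (near_rich K k g)%:R * (`|i%:R - (z g - 1 / 2)| < 3%N%:R :> R)%:R)).
  apply: ler_sum => i _.
  have S0 : 0 <= \sum_(g <- words k)
      (near_rich K k g)%:R * (`|i%:R - (z g - 1 / 2)| < 3%N%:R :> R)%:R :> R.
    by apply: sumr_ge0 => g _; rewrite mulr_ge0 ?ler0n.
  case: (boolP (hit_cell K k i)) => [|_]; last by rewrite mulr0.
  case/hasP => u hu /andP[/hasP[a ha /andP[hK nua]] /eqP ui].
  rewrite mulr1; apply: (le_trans (ltW hK)).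
  rewrite /neighbours; rewrite big_seq [leRHS]big_seq; apply: ler_sum => g hg.
  case: (boolP (near c k a g)) => nag; last by rewrite mulr_ge0 ?ler0n.
  have -> : near_rich K k g.
    by apply/hasP; exists a => //; rewrite hK /near distrC.
  rewrite (_ : (`|_| < _)%R = true) ?mulr1 //.
  have /andP[u1 u2] := cell_itv c_le1 k u; rewrite ui in u1 u2.
  move: nua nag; rewrite !nearE !ler_norml => /andP[a1 a2] /andP[b1 b2].
  by rewrite ltr_norml /z; apply/andP; split; lra.
rewrite exchange_big /= mulr_sumr; apply: ler_sum => g _.
rewrite -mulr_sumr mulrC ler_wpM2r ?ler0n //.
exact: count_window.
Qed.

(** The removed words of length [k] are covered cell by cell, regardless of their
    continuation, and each of the other words carries a copy of the generation
    [n] shadow scaled by 3^-k. *)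
Lemma coverable_rec (K : R) k n l : 0 < K ->
  coverable (shadow n) l ->
  coverable (shadow (k + n))
    (24 / K * (3 ^- k * near_rich_count K k)
     + (1 - 3 ^- k * near_rich_count K k) * l).
Proof.
move=> K0 [s [s0 sA sl]].
have pk := @pow3_gt0 R k.
pose s1 := [seq ((nat_of_ord i)%:R * 3 ^- k - 1 : R, 2 * 3 ^- k : R) |
   i <- enum 'I_(2 * 3 ^ k) & hit_cell K k (nat_of_ord i)].
pose s2 := [seq (pos c u + 3 ^- k * p.1, 3 ^- k * p.2) |
   u <- [seq u <- words k | ~~ near_rich K k u], p <- s].
exists (s1 ++ s2); split.
- move=> p; rewrite mem_cat => /orP[/mapP[i _ ->] /=|]; first by rewrite mulr_ge0 // ltW.
  case/allpairsP => -[u q] /= [_ /s0 q0 ->] /=; by rewrite mulr_ge0 // ltW.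
- move=> x [w /words_cat[u [v [hu hv ->]]] h].
  case: (boolP (near_rich K k u)) => nr.
    have xu := shadow_prefix hu hv h.
    have /andP[u1 u2] := cell_itv c_le1 k u.
    exists ((cell c k u)%:R * 3 ^- k - 1, 2 * 3 ^- k).
      rewrite mem_cat; apply/orP; left; apply/mapP.
      exists (Ordinal (cell_lt c_le1 k u)) => //=.
      rewrite mem_filter mem_enum andbT; apply/hasP; exists u => //.
      by rewrite nr eqxx.
    have e : pos c u + 1 = 3 ^- k * (3 ^+ k * (pos c u + 1)).
      by rewrite mulrA mulVf ?mul1r // expf_neq0.
    have h1 := ler_wpM2l (ltW pk) u1; rewrite -e in h1.
    move: u2; rewrite -(ltr_pM2l pk) -e => u2.
    by move: xu; rewrite /= !ltr_norml => /andP[x1 x2]; apply/andP; split; lra.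
  have [|p ps hp] := sA (3 ^+ k * (x - pos c u)).
    exists v => //; move: h; rewrite pos_cat (size_words hu) exprD invfM => h.
    have -> : 3 ^+ k * (x - pos c u) - pos c v =
       3 ^+ k * (x - (pos c u + 3 ^- k * pos c v)).
      by field; rewrite expf_neq0.
    rewrite normrM gtr0_norm ?exprn_gt0 // -(ltr_pM2l pk).
    by rewrite mulKf ?expf_neq0.
  exists (pos c u + 3 ^- k * p.1, 3 ^- k * p.2).
    rewrite mem_cat; apply/orP; right; apply/allpairsP; exists (u, p).
    by rewrite mem_filter nr hu.
  have -> : x - (pos c u + 3 ^- k * p.1) = 3 ^- k * (3 ^+ k * (x - pos c u) - p.1).
    by field; rewrite expf_neq0.
  by rewrite normrM gtr0_norm //= ltr_pM2l.
rewrite big_cat /=; apply: lerD.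
  rewrite big_map big_filter big_enum_cond /=.
  have h := hit_cells_le k (2 * 3 ^ k) (ltW K0).
  have -> : \sum_(i < 2 * 3 ^ k | hit_cell K k i) 2 * (2 * 3 ^- k) =
      4 * 3 ^- k * \sum_(i < 2 * 3 ^ k) (hit_cell K k i)%:R :> R.
    rewrite mulr_sumr big_mkcond; apply: eq_bigr => i _.
    by case: hit_cell; rewrite /= ?mulr0 ?mulr1 //; ring.
  have -> : 24 / K * (3 ^- k * near_rich_count K k) =
      4 * 3 ^- k * (6 * near_rich_count K k / K) by ring.
  apply: ler_wpM2l; first by rewrite mulr_ge0 // ltW.
  by rewrite ler_pdivlMr // mulrC.
rewrite big_allpairs_dep big_filter /=.
under eq_bigr => u _.
  rewrite (eq_bigr (fun p => 3 ^- k * (2 * p.2))); last by move=> p _; rewrite mulrCA.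
  rewrite -mulr_sumr; over.
have -> : \sum_(u <- words k | ~~ near_rich K k u) 3 ^- k * (\sum_(p <- s) 2 * p.2)
   = (1 - 3 ^- k * near_rich_count K k) * \sum_(p <- s) 2 * p.2.
  have -> : 1 - 3 ^- k * near_rich_count K k =
      3 ^- k * \sum_(u <- words k) (1 - (near_rich K k u)%:R).
    by rewrite sumrB mulrBr sum_words_const mulr1 mulVf // expf_neq0.
  rewrite [X in _ = X * _]mulr_sumr mulr_suml big_mkcond; apply: eq_bigr => u _ /=.
  by case: near_rich; rewrite /= ?subrr ?subr0 ?mulr0 ?mul0r ?mulr1.
rewrite ler_wpM2l // subr_ge0 mulrC ler_pdivrMr ?exprn_gt0 // mul1r.
rewrite -[leRHS]mulr1 -sum_words_const /near_rich_count; apply: ler_sum => u _.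
by rewrite lern1 leq_b1.
Qed.

Lemma coverable_shadow n : coverable (shadow n) 2.
Proof.
exists [:: (0, 1)]; split.
- by move=> p; rewrite inE => /eqP ->.
- move=> x /(shadow_mono (leq0n n)) [w]; rewrite inE => /eqP ->.
  by rewrite expr0 invr1 => h; exists (0, 1); rewrite ?inE.
- by rewrite big_seq1 /= mulr1.
Qed.

(** The affine recursion of [coverable_rec] has the fixed point 24 / K, to which it
    contracts by the density of the words that are kept. *)
Lemma coverable_blocks (K : R) k L : 0 < K ->
  coverable (shadow (k * L))
    (24 / K + 2 * (1 - 3 ^- k * near_rich_count K k) ^+ L).
Proof.
move=> K0; elim: L => [|L IH].
  rewrite muln0 expr0 mulr1; apply: coverable_le (coverable_shadow 0) => //.
  by rewrite lerDr divr_ge0 // ltW.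
rewrite mulnS; apply: coverable_le (coverable_rec k K0 IH) => //.
rewrite exprS; set p := 3 ^- k * _; set q := 24 / K; set r := _ ^+ L; lra.
Qed.

Lemma coverable_of_rich (K eta : R) k N L n : 0 < K -> 0 < eta ->
  (k <= N)%N -> (0 < L)%N -> (N * L <= n)%N -> 3 ^+ k * eta < rich_count c K k ->
  coverable (shadow n) (24 / K + 2 / (L%:R * eta)).
Proof.
move=> K0 e0 kN L0 nNL h.
apply: coverable_le (coverable_blocks k L K0).
  by move=> x; apply: shadow_mono; apply: leq_trans nNL; rewrite leq_mul2r kN orbT.
rewrite lerD2l ler_wpM2l //; set p := 3 ^- k * _.
have ep : eta <= p.
  rewrite /p mulrC ler_pdivlMr ?exprn_gt0 // mulrC; apply: (le_trans (ltW h)).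
  rewrite /rich_count /near_rich_count big_seq [leRHS]big_seq; apply: ler_sum => u hu.
  rewrite ler_nat; case: ltP => // /(near_rich_refl hu) -> //.
have p1 : p <= 1.
  rewrite /p mulrC ler_pdivrMr ?exprn_gt0 // mul1r.
  rewrite -[leRHS]mulr1 -sum_words_const /near_rich_count; apply: ler_sum => u _.
  by rewrite lern1 leq_b1.
(* (1 - p)^L <= 1 / (1 + L p), a consequence of Bernoulli's inequality. *)
have B : (1 - p) ^+ L * (1 + L%:R * p) <= 1.
  elim: (L) => [|m IH]; first by rewrite expr0 mul0r addr0 mulr1.
  apply: le_trans IH; rewrite exprS -[m.+1%:R]natr1.
  have h0 : 0 <= (1 - p) ^+ m by rewrite exprn_ge0 // subr_ge0.
  have hm : 0 <= m%:R :> R by [].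
  have hq : (1 - p) * (1 + (m%:R + 1) * p) <= 1 + m%:R * p by nra.
  by have := ler_wpM2l h0 hq; lra.
have LR : 0 < L%:R :> R by rewrite ltr0n.
have Le : 0 < L%:R * eta by rewrite mulr_gt0.
rewrite -[leRHS]mul1r ler_pdivlMr //; apply: le_trans B.
apply: ler_wpM2l; first by rewrite exprn_ge0 // subr_ge0.
have := ler_wpM2l (ltW LR) ep; lra.
Qed.

End Cover.

(** * Sums of three unit phases *)

Section Phases.
Context {R : realType}.
Implicit Types x y z t : R.

Lemma cos_triple t : cos (3 * t) = 4 * cos t ^+ 3 - 3 * cos t.
Proof.
have -> : 3 * t = t + (t + t) by ring.
rewrite cosD (cosD t t) (sinD t t).
have := cos2Dsin2 t; move: (cos t) (sin t) => C S h.
have -> : C * (C * C - S * S) - S * (S * C + C * S) = C ^+ 3 - 3 * C * S ^+ 2 by ring.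
have -> : S ^+ 2 = 1 - C ^+ 2 by rewrite -h addrC addKr.
by ring.
Qed.

Lemma one_sub_cos_triple t : 1 - cos (3 * t) = (1 - cos t) * (1 + 2 * cos t) ^+ 2.
Proof. by rewrite cos_triple; ring. Qed.

(** The squared modulus of e^(ix) + e^(iy) + e^(iz). *)
Definition phase_sum2 x y z : R :=
  (cos x + cos y + cos z) ^+ 2 + (sin x + sin y + sin z) ^+ 2.

Lemma phase_sum2E x y z :
  phase_sum2 x y z = 3 + 2 * (cos (x - y) + cos (y - z) + cos (z - x)).
Proof.
rewrite /phase_sum2 !cosB.
have := cos2Dsin2 x; have := cos2Dsin2 y; have := cos2Dsin2 z; lra.
Qed.

Lemma phase_sum2_ge0 x y z : 0 <= phase_sum2 x y z.
Proof. by rewrite addr_ge0 ?sqr_ge0. Qed.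

Lemma phase_sum2_le9 x y z : phase_sum2 x y z <= 9.
Proof.
rewrite phase_sum2E.
have := cos_le1 (x - y); have := cos_le1 (y - z); have := cos_le1 (z - x); lra.
Qed.

Lemma phase_sum2_rot x y z : phase_sum2 x y z = phase_sum2 y z x.
Proof. by rewrite /phase_sum2; congr (_ ^+ 2 + _ ^+ 2); ring. Qed.

(** Near the maximum 9 the defect is quadratic in the phase differences, so
    tripling them multiplies it by at most 9. *)
Lemma phase_defect_triple x y z :
  9 - phase_sum2 (3 * x) (3 * y) (3 * z) <= 9 * (9 - phase_sum2 x y z).
Proof.
have aux t : 1 - cos (3 * t) <= 9 * (1 - cos t).
  rewrite one_sub_cos_triple mulrC; have := cos_le1 t; have := cos_geN1 t.
  move: (cos t) => C h1 h2; apply: ler_wpM2r; [lra|nra].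
rewrite !phase_sum2E -!mulrBr.
have := aux (x - y); have := aux (y - z); have := aux (z - x); lra.
Qed.

(** If the three unit vectors nearly cancel, the sum of the first two nearly is
    minus the third one and so has modulus nearly 1, which pins the cosine of
    their angle to -1/2. *)
Lemma phase_near_third x y z :
  (1 + 2 * cos (x - y)) ^+ 2 <= 26 * phase_sum2 x y z.
Proof.
have h9 := phase_sum2_le9 x y z; have h0 := phase_sum2_ge0 x y z.
(* D is the component of the total sum along the third vector. *)
pose D := (cos x + cos y + cos z) * cos z + (sin x + sin y + sin z) * sin z.
have e : 1 + 2 * cos (x - y) = phase_sum2 x y z - 2 * D.
  rewrite phase_sum2E /D !cosB.
  have := cos2Dsin2 z; lra.
have D2 : D ^+ 2 <= phase_sum2 x y z.
  rewrite /D /phase_sum2; move: (_ + _ + cos z) (_ + _ + sin z) (cos2Dsin2 z).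
  move: (cos z) (sin z) => a b A B h.
  have -> : A ^+ 2 + B ^+ 2 = (A ^+ 2 + B ^+ 2) * (a ^+ 2 + b ^+ 2) by rewrite h mulr1.
  have := sqr_ge0 (A * b - B * a); lra.
rewrite e; have := sqr_ge0 (phase_sum2 x y z + 2 * D); nra.
Qed.

Lemma one_sub_cos_triple_le x y z :
  1 - cos (3 * (x - y)) <= 52 * phase_sum2 x y z.
Proof.
rewrite one_sub_cos_triple; have := phase_near_third x y z.
have := cos_geN1 (x - y); have := sqr_ge0 (1 + 2 * cos (x - y)); nra.
Qed.

(** Where the three unit vectors nearly cancel they are nearly a rotated copy of
    the cube roots of unity, and tripling the phases nearly aligns them. *)
Lemma phase_defect_triple_le x y z :
  9 - phase_sum2 (3 * x) (3 * y) (3 * z) <= 312 * phase_sum2 x y z.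
Proof.
rewrite [in X in X <= _]phase_sum2E -!mulrBr.
have := one_sub_cos_triple_le x y z; have := one_sub_cos_triple_le y z x.
have := one_sub_cos_triple_le z x y.
rewrite (phase_sum2_rot z) (phase_sum2_rot x); lra.
Qed.

End Phases.

(** * The characteristic function of the projected centres *)

Section Power.
Context {R : realType} (c : 'I_3 -> R).

Definition cos_sum n (t : R) : R := \sum_(w <- words n) cos (t * pos c w).
Definition sin_sum n (t : R) : R := \sum_(w <- words n) sin (t * pos c w).
(** The squared modulus of the average of e^(i t x) over the points x of
    generation [n]. *)
Definition power n (t : R) : R := (cos_sum n t ^+ 2 + sin_sum n t ^+ 2) / 9 ^+ n.
(** The factor 3 removes the contraction of the first letter: [symbol t] only
    involves the three phases [t * c a]. *)
Definition symbol (t : R) : R := power 1 (3 * t).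

Lemma power_ge0 n t : 0 <= power n t.
Proof. by rewrite divr_ge0 ?addr_ge0 ?sqr_ge0 ?exprn_ge0. Qed.

(** The set of points is an arithmetic sum, so its characteristic function is a
    product. *)
Lemma power_cat k n t : power (k + n) t = power k t * power n (3 ^- k * t).
Proof.
have e u v : u \in words k ->
    t * pos c (u ++ v) = t * pos c u + 3 ^- k * t * pos c v.
  by move=> /size_words su; rewrite pos_cat su; ring.
have C : cos_sum (k + n) t = cos_sum k t * cos_sum n (3 ^- k * t)
    - sin_sum k t * sin_sum n (3 ^- k * t).
  rewrite /cos_sum sum_words_cat !mulr_suml -sumrB big_seq [RHS]big_seq.
  apply: eq_bigr => u hu; rewrite !mulr_sumr -sumrB; apply: eq_bigr => v _.
  by rewrite e // cosD.
have S : sin_sum (k + n) t = sin_sum k t * cos_sum n (3 ^- k * t)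
    + cos_sum k t * sin_sum n (3 ^- k * t).
  rewrite /sin_sum sum_words_cat !mulr_suml -big_split big_seq [RHS]big_seq.
  apply: eq_bigr => u hu; rewrite !mulr_sumr -big_split; apply: eq_bigr => v _.
  by rewrite e // sinD.
rewrite /power C S exprD; field; rewrite !expf_neq0 //.
Qed.

Lemma power_pairs n t : power n t =
  9 ^- n * \sum_(u <- words n) \sum_(v <- words n) cos (t * (pos c u - pos c v)).
Proof.
rewrite /power mulrC; congr (_ * _).
rewrite !expr2 /cos_sum /sin_sum !mulr_suml -big_split; apply: eq_bigr => u _.
rewrite !mulr_sumr -big_split; apply: eq_bigr => v _.
by rewrite mulrBr cosB.
Qed.

Lemma symbolE t : symbol t =
  phase_sum2 (t * c 0) (t * c 1) (t * c (inord 2)) / 9.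
Proof.
rewrite /symbol /power expr1 /cos_sum /sin_sum !sum_words1 /phase_sum2.
have e a : 3 * t * pos c [:: a] = t * c a by rewrite /= addr0; field.
rewrite !(eq_bigr _ (fun a _ => congr1 cos (e a))) !(eq_bigr _ (fun a _ => congr1 sin (e a))).
rewrite !big_ord_recl !big_ord0 !addr0 !addrA.
have -> : lift ord0 ord0 = 1 :> 'I_3 by apply: val_inj.
have -> : lift ord0 (lift ord0 ord0) = inord 2 :> 'I_3 by apply: val_inj; rewrite /= inordK.
by [].
Qed.

Lemma symbol_ge0 t : 0 <= symbol t.
Proof. exact: power_ge0. Qed.

Lemma symbol_le1 t : symbol t <= 1.
Proof. by rewrite symbolE; have := phase_sum2_le9 (t * c 0) (t * c 1) (t * c (inord 2)); lra. Qed.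

Lemma symbol_triple t : 1 - symbol (3 * t) <= 9 * (1 - symbol t).
Proof.
rewrite !symbolE -!(mulrA 3).
have := phase_defect_triple (t * c 0) (t * c 1) (t * c (inord 2)); lra.
Qed.

Lemma symbol_triple_le t : 1 - symbol (3 * t) <= 312 * symbol t.
Proof.
rewrite !symbolE -!(mulrA 3).
have := phase_defect_triple_le (t * c 0) (t * c 1) (t * c (inord 2)); lra.
Qed.

(** The summand [1 - symbol y] on the right records how much of the run of values
    close to 1 that follows a small factor is still ahead.  If [symbol y] is at
    least 1/9, the bound [symbol_triple] shows that this quantity grows at most
    ninefold in one step; if [symbol y] is small, [symbol_triple_le] makes the
    next value of it equally small, which compensates for the small factor.
    The summand [d] covers a run that is cut off by the end of the product. *)
Lemma power_lower_aux (d : R) m y : 0 < d -> d <= 1 ->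
  (forall j, (j < m)%N -> d <= symbol (3 ^+ j * y)) ->
  d * 729 ^- m <= power m (3 ^+ m * y) * (1 - symbol y + d).
Proof.
move=> d0 d1; elim: m y => [|m IH] y hs.
  have -> : power 0 (3 ^+ 0 * y) = 1.
    rewrite /power /cos_sum /sin_sum !big_seq1 /= mulr0 cos0 sin0 !expr0 invr1.
    by rewrite expr1n expr0n addr0 mulr1.
  rewrite expr0 invr1 mulr1 mul1r lerDr; have := symbol_le1 y; lra.
(* The factor with the smallest argument is split off, and the rest is the same
   product started at 3 y. *)
have e : power m.+1 (3 ^+ m.+1 * y) = power m (3 ^+ m * (3 * y)) * symbol y.
  rewrite -addn1 power_cat addn1 exprS /symbol; congr (_ * _).
    by congr power; ring.
  by congr power; field; rewrite expf_neq0.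
have {}IH : d * 729 ^- m <= power m (3 ^+ m * (3 * y)) * (1 - symbol (3 * y) + d).
  by apply: IH => j jm; rewrite mulrA -exprSr; apply: hs.
have h0 : d <= symbol y by have := hs 0%N isT; rewrite expr0 mul1r.
have h1 := symbol_le1 y; have h2 := symbol_triple y; have h3 := symbol_triple_le y.
have P0 := power_ge0 m (3 ^+ m * (3 * y)).
have c0 : 0 < 729 :> R by rewrite ltr0n.
rewrite e [729 ^+ m.+1]exprS invfM mulrCA (ler_pdivrMl _ _ c0); apply: (le_trans IH).
move: (power m _) P0 h0 h1 h2 h3 => P P0.
move: (symbol y) (symbol (3 * y)) => s s' h0 h1 h2 h3.
have -> : 729 * (P * s * (1 - s + d)) = P * (729 * (s * (1 - s + d))) by ring.
apply: ler_wpM2l => //; case: (leP (1 / 9) s) => h.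
  have q0 : 0 <= 1 - s + d by lra.
  have q1 : 0 <= s - 1 / 9 by lra.
  by have := mulr_ge0 q1 q0; lra.
have : 8 / 9 * s <= s * (1 - s + d) by nra.
lra.
Qed.

Lemma power_lower (d : R) m t : 0 < d -> d <= 1 -> 0 <= t <= 3 ^+ m ->
  (forall u, 0 <= u <= 3 ^+ m -> d <= symbol u) ->
  d * 729 ^- m / 2 <= power m t.
Proof.
move=> d0 d1 /andP[t0 tm] hs.
have /= := @power_lower_aux d m (3 ^- m * t) d0 d1.
rewrite mulrA divff ?expf_neq0 // mul1r => h.
have s1 := symbol_ge0 (3 ^- m * t); have p0 := power_ge0 m t.
rewrite ler_pdivrMr //; apply: le_trans (h _) _.
  move=> j jm; apply: hs; rewrite mulrA; apply/andP; split.
    by rewrite !mulr_ge0 ?exprn_ge0 // invr_ge0 exprn_ge0.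
  apply: le_trans tm; rewrite -[leRHS]mul1r ler_wpM2r //.
  by rewrite ler_pdivrMr ?exprn_gt0 // mul1r ler_weXn2l ?ler1n // ltnW.
by apply: ler_wpM2l => //; lra.
Qed.

End Power.

(** * Integrals of continuous functions over segments *)

Section Integral.
Context {R : realType}.
Notation mu := (@lebesgue_measure R).
Implicit Types (f g F : R -> R) (a b x y T : R).

Definition integ a b f : R := (\int[mu]_(t in `[a, b]) f t)%R.

Lemma integ_ok a b f : continuous f -> mu.-integrable `[a, b] (EFin \o f).
Proof.
move=> cf; apply: continuous_compact_integrable; first exact: segment_compact.
exact: continuous_subspaceT.
Qed.

Lemma integ_le a b f g : continuous f -> continuous g ->
  (forall t, a <= t <= b -> f t <= g t) -> integ a b f <= integ a b g.
Proof.
move=> cf cg fg; apply: le_Rintegral => //; exact: integ_ok.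
Qed.

Lemma integ_ge0 a b f : (forall t, a <= t <= b -> 0 <= f t) -> 0 <= integ a b f.
Proof. by move=> f0; apply: Rintegral_ge0 => t /=; rewrite in_itv /= => /f0. Qed.

Lemma integD a b f g : continuous f -> continuous g ->
  integ a b (fun t => f t + g t) = integ a b f + integ a b g.
Proof. by move=> cf cg; rewrite /integ RintegralD //; exact: integ_ok. Qed.

Lemma integZ a b k f : continuous f ->
  integ a b (fun t => k * f t) = k * integ a b f.
Proof. by move=> cf; rewrite /integ RintegralZl //; exact: integ_ok. Qed.

Lemma continuous_bigsum (I : Type) (s : seq I) (f : I -> R -> R) :
  (forall i, continuous (f i)) -> continuous (fun t => \sum_(i <- s) f i t).
Proof.
move=> cf; elim: s => [|i s IH] t.
  by under eq_fun do rewrite big_nil; exact: cst_continuous.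
under eq_fun do rewrite big_cons; apply: continuousD; [exact: cf|exact: IH].
Qed.

Lemma integ_sum (I : Type) (s : seq I) a b (f : I -> R -> R) :
  (forall i, continuous (f i)) ->
  integ a b (fun t => \sum_(i <- s) f i t) = \sum_(i <- s) integ a b (f i).
Proof.
move=> cf; elim: s => [|i s IH].
  rewrite big_nil; under [X in integ _ _ X]eq_fun do rewrite big_nil.
  by rewrite /integ Rintegral_cst // mul0r.
rewrite big_cons -IH -integD //; last exact: continuous_bigsum.
by congr integ; apply/funext => t; rewrite big_cons.
Qed.

Lemma integ_cat a b e f : continuous f -> a <= b -> b <= e ->
  integ a e f = integ a b f + integ b e f.
Proof.
move=> cf ab be; apply/eqP; rewrite -subr_eq0 opprD addrA subr_eq0; apply/eqP.
rewrite /integ (@Rintegral_itvB _ f (BLeft a) (BRight e) b) ?bnd_simp //; last exact: integ_ok.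
rewrite Rintegral_itv_obnd_cbnd //.
apply: integrableS (integ_ok b e cf) => //.
exact: subset_itv_oc_cc.
Qed.

Lemma integ_FTC a b f F : a < b -> continuous f ->
  (forall x, is_derive x 1 F (f x)) -> integ a b f = F b - F a.
Proof.
move=> ab cf dF; rewrite /integ /Rintegral (@continuous_FTC2 _ f F) //.
- exact: continuous_subspaceT.
- have cF x : {for x, continuous F}.
    apply: differentiable_continuous; apply/derivable1_diffP.
    by have [] := dF x.
  split; first by move=> x _; have [] := dF x.
    by apply: cvg_at_right_filter; apply: cF.
  by apply: cvg_at_left_filter; apply: cF.
- by move=> x _; rewrite derive1E; have [_ ->] := dF x.
Qed.

End Integral.

(** * The triangle weight and elementary trigonometric bounds *)

Section Fejer.
Context {R : realType}.
Implicit Types (f g F G : R -> R) (a b x y z T t : R).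

Lemma is_derive_affine a b x : is_derive x 1 (fun t => a + b * t) b.
Proof.
apply: (is_derive_eq (is_deriveD (is_derive_cst a x 1) (is_deriveZ b (is_derive_id x 1)))).
by rewrite add0r /GRing.scale /= mulr1.
Qed.

Lemma is_derive_add F G x df dg : is_derive x 1 F df -> is_derive x 1 G dg ->
  is_derive x 1 (fun t => F t + G t) (df + dg).
Proof. by move=> dF dG; exact: is_deriveD. Qed.

Lemma is_derive_mul F G x df dg : is_derive x 1 F df -> is_derive x 1 G dg ->
  is_derive x 1 (fun t => F t * G t) (F x * dg + G x * df).
Proof. by move=> dF dG; exact: is_deriveM. Qed.

Lemma is_derive_sin_scale y x : is_derive x 1 (fun t => sin (t * y)) (y * cos (x * y)).
Proof.
have d : is_derive x 1 (fun t => t * y) y.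
  have := is_derive_affine 0 y x; rewrite (_ : (fun t => 0 + y * t) = (fun t => t * y)) //.
  by apply/funext => t; rewrite add0r mulrC.
by apply: (is_derive_eq (is_derive1_comp (is_derive_sin _) d)); rewrite mulrC.
Qed.

Lemma is_derive_cos_scale y x : is_derive x 1 (fun t => cos (t * y)) (- y * sin (x * y)).
Proof.
have d : is_derive x 1 (fun t => t * y) y.
  have := is_derive_affine 0 y x; rewrite (_ : (fun t => 0 + y * t) = (fun t => t * y)) //.
  by apply/funext => t; rewrite add0r mulrC.
by apply: (is_derive_eq (is_derive1_comp (is_derive_cos _) d)); rewrite mulrC mulrN mulNr.
Qed.

Lemma continuous_affine a b : continuous (fun t : R => a + b * t).
Proof.
move=> x; apply: differentiable_continuous; apply/derivable1_diffP.
by have [] := is_derive_affine a b x.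
Qed.

Lemma continuous_cos_scale y : continuous (fun t : R => cos (t * y)).
Proof.
move=> x; apply: differentiable_continuous; apply/derivable1_diffP.
by have [] := is_derive_cos_scale y x.
Qed.

Lemma continuous_mul f g : continuous f -> continuous g ->
  continuous (fun t => f t * g t).
Proof. by move=> cf cg x; apply: continuousM; [exact: cf|exact: cg]. Qed.

Lemma continuous_add f g : continuous f -> continuous g ->
  continuous (fun t => f t + g t).
Proof. by move=> cf cg x; apply: continuousD; [exact: cf|exact: cg]. Qed.

(** The Fourier transform of the triangle weight on [0, T].  It is nonnegative,
    which allows dropping off-diagonal pairs in lower bounds, and decays
    quadratically, which localizes upper bounds to close pairs. *)
Definition fejer T y : R := integ 0 T (fun t => (1 + - T^-1 * t) * cos (t * y)).

Lemma continuous_fejer T y : continuous (fun t => (1 + - T^-1 * t) * cos (t * y)).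
Proof. apply: continuous_mul; [exact: continuous_affine|exact: continuous_cos_scale]. Qed.

Lemma fejer0 T : 0 < T -> fejer T 0 = T / 2.
Proof.
move=> T0; rewrite /fejer.
have dF x : is_derive x 1 (fun t => (0 + 1 * t) * (1 + - (2 * T)^-1 * t))
    ((1 + - T^-1 * x) * cos (x * 0)).
  apply: (is_derive_eq (is_derive_mul (is_derive_affine 0 1 x)
    (is_derive_affine 1 (- (2 * T)^-1) x))).
  by rewrite mulr0 cos0; field; rewrite gt_eqF.
rewrite (integ_FTC T0 (@continuous_fejer T 0) dF).
by field; rewrite gt_eqF.
Qed.

Lemma fejerE T y : 0 < T -> y != 0 -> fejer T y = (1 - cos (T * y)) / (T * y ^+ 2).
Proof.
move=> T0 y0; rewrite /fejer.
have dF x : is_derive x 1 (fun t =>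
    (1 + - T^-1 * t) * ((y^-1 + 0 * t) * sin (t * y)) +
    (- (T * y ^+ 2)^-1 + 0 * t) * cos (t * y)) ((1 + - T^-1 * x) * cos (x * y)).
  apply: (is_derive_eq (is_derive_add
    (is_derive_mul (is_derive_affine 1 (- T^-1) x)
      (is_derive_mul (is_derive_affine y^-1 0 x) (is_derive_sin_scale y x)))
    (is_derive_mul (is_derive_affine (- (T * y ^+ 2)^-1) 0 x)
      (is_derive_cos_scale y x)))).
  by field; rewrite y0 gt_eqF.
rewrite (integ_FTC T0 (@continuous_fejer T y) dF).
by rewrite !mul0r cos0 sin0; field; rewrite y0 gt_eqF.
Qed.

Lemma fejer_ge0 T y : 0 < T -> 0 <= fejer T y.
Proof.
move=> T0; have [->|y0] := eqVneq y 0; first by rewrite fejer0 // divr_ge0 // ltW.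
by rewrite fejerE // divr_ge0 ?subr_ge0 ?cos_le1 // mulr_ge0 ?sqr_ge0 // ltW.
Qed.

Lemma fejer_le_half T y : 0 < T -> fejer T y <= T / 2.
Proof.
move=> T0; rewrite -fejer0 //; apply: integ_le; try exact: continuous_fejer.
move=> t /andP[t0 tT]; rewrite mulr0 cos0 ler_wpM2l ?cos_le1 //.
by rewrite mulNr subr_ge0 ler_pdivrMl // mulr1.
Qed.

Lemma fejer_le_inv T y : 0 < T -> y != 0 -> fejer T y <= 2 / (T * y ^+ 2).
Proof.
move=> T0 y0; rewrite fejerE // ler_wpM2r //.
  by rewrite invr_ge0 mulr_ge0 ?sqr_ge0 // ltW.
by have := cos_geN1 (T * y); lra.
Qed.

(** Integrating [cos t <= 1] twice. *)
Lemma one_sub_cos_le x : 1 - cos x <= x ^+ 2 / 2.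
Proof.
wlog x0 : x / 0 < x.
  move=> h; have [x0|x0|<-] := ltgtP 0 x; first exact: h.
    by rewrite -cosN -sqrrN; apply: h; rewrite oppr_gt0.
  by rewrite cos0 subrr expr0n mul0r.
have dcos t : is_derive t 1 (fun t : R => sin (t * 1)) (cos (t * 1)).
  by have := is_derive_sin_scale 1 t; rewrite mul1r.
have sin_le z : 0 < z -> sin z <= z.
  move=> z0; have : integ 0 z (fun t => cos (t * 1)) <= integ 0 z (fun t => 1 + 0 * t).
    apply: integ_le; [exact: continuous_cos_scale|exact: continuous_affine|].
    by move=> t _; rewrite mul0r addr0 cos_le1.
  rewrite (integ_FTC z0 (@continuous_cos_scale 1) dcos).
  have did t : is_derive t 1 (fun t : R => 0 + 1 * t) (1 + 0 * t).
    by apply: (is_derive_eq (is_derive_affine 0 1 t)); rewrite mul0r addr0.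
  rewrite (integ_FTC z0 (@continuous_affine 1 0) did).
  by rewrite !mulr1 !mul1r sin0 subr0 !add0r subr0.
have : integ 0 x (@sin R) <= integ 0 x (fun t => 0 + 1 * t).
  apply: integ_le; [exact: continuous_sin|exact: continuous_affine|].
  move=> t /andP[t0 _]; rewrite add0r mul1r.
  by have [->|t1] := eqVneq t 0; [rewrite sin0|apply: sin_le; rewrite lt_def t1].
have dsin t : is_derive t 1 (fun t : R => (-1 + 0 * t) * cos (t * 1)) (sin t).
  apply: (is_derive_eq (is_derive_mul (is_derive_affine (-1) 0 t) (is_derive_cos_scale 1 t))).
  by rewrite mulr1; ring.
rewrite (integ_FTC x0 (@continuous_sin R) dsin).
have did t : is_derive t 1 (fun t : R => (0 + 2^-1 * t) * (0 + 1 * t)) (0 + 1 * t).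
  apply: (is_derive_eq (is_derive_mul (is_derive_affine 0 2^-1 t) (is_derive_affine 0 1 t))).
  by field.
rewrite (integ_FTC x0 (@continuous_affine 0 1) did).
rewrite !mul0r mulr1 cos0; lra.
Qed.

(** Integrating [one_sub_cos_le] gives [sin x >= x - x^3 / 6].  The range [0, 2]
    contains [0, pi / 2] because pi <= 4. *)
Lemma sin_ge_third x : 0 <= x <= 2 -> x / 3 <= sin x.
Proof.
case/andP; rewrite le_eqVlt => /predU1P[<- _|x0 x2]; first by rewrite sin0 mul0r.
have cq : continuous (fun t : R => 1 + (0 + - 2^-1 * t) * (0 + 1 * t)).
  apply: (@continuous_add (fun=> 1)); first exact: cst_continuous.
  by apply: continuous_mul; exact: continuous_affine.
have : integ 0 x (fun t => 1 + (0 + - 2^-1 * t) * (0 + 1 * t)) <= integ 0 x (@cos R).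
  apply: integ_le; [exact: cq|exact: continuous_cos|].
  by move=> t _; have := one_sub_cos_le t; lra.
rewrite (integ_FTC x0 (@continuous_cos R) (@is_derive_sin R)) sin0 subr0.
have dq t : is_derive t 1
    (fun t : R => (0 + 1 * t) * (1 + (0 + - 6^-1 * t) * (0 + 1 * t)))
    (1 + (0 + - 2^-1 * t) * (0 + 1 * t)).
  have d1 := is_derive_affine 0 1 t.
  have d2 := is_derive_mul (is_derive_affine 0 (- 6^-1) t) d1.
  have d0 : is_derive t 1 (fun=> 1 : R) 0 by exact: is_derive_cst.
  apply: (is_derive_eq (is_derive_mul d1 (is_derive_add d0 d2))).
  by field.
rewrite (integ_FTC x0 cq dq) mulr0 addr0 !mul0r subr0.
apply: le_trans; rewrite !add0r !mul1r mulrDr mulr1.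
have : x * x <= 4 by nra.
nra.
Qed.

End Fejer.

(** * Energy grows at non-resonant angles *)

Section PowerIntegral.
Context {R : realType} (c : 'I_3 -> R).
Hypothesis c_le1 : forall a, `|c a| <= 1.
Implicit Types T t x : R.

(** Both halves of the sum telescope, by comparing 1 / (1 + x)^2 with
    1 / x - 1 / (x + 1); the diagonal term gives the third unit. *)
Lemma near_sum_inv_sq_le (i B : nat) :
  \sum_(j < B) ((1 + `|i%:R - j%:R|) ^+ 2)^-1 <= 3 :> R.
Proof.
have tele (x : R) : 0 < x -> ((1 + x) ^+ 2)^-1 <= x^-1 - (x + 1)^-1.
  move=> x0; have -> : x^-1 - (x + 1)^-1 = (x * (x + 1))^-1.
    by field; rewrite !gt_eqF //; lra.
  by rewrite lef_pV2 ?posrE ?mulr_gt0 ?exprn_gt0 //; nra.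
pose S B : R := \sum_(j < B) ((1 + `|i%:R - j%:R|) ^+ 2)^-1.
have below m : (m <= i)%N -> S m <= ((i - m)%:R + 1)^-1.
  elim: m => [|m IH] mi; first by rewrite /S big_ord0 invr_ge0 addr_ge0.
  have {IH} := IH (ltnW mi); rewrite /S big_ord_recr /=.
  have im : (0 < i - m)%N by rewrite subn_gt0.
  have -> : `|i%:R - m%:R| = (i - m)%:R :> R by rewrite -natrB ?normr_nat // ltnW.
  have -> : (i - m.+1)%:R + 1 = (i - m)%:R :> R by rewrite subnS natr1 prednK.
  have := tele (i - m)%:R; rewrite ltr0n => /(_ im).
  move: (\sum_(_ < _) _) => s; lra.
have above m : S (i.+1 + m)%N <= 3 - (m.+1%:R)^-1.
  elim: m => [|m IH].
    rewrite addn0 /S big_ord_recr /= subrr normr0 addr0 expr1n invr1.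
    have := below i (leqnn i); rewrite subnn add0r invr1 /S; lra.
  rewrite addnS /S big_ord_recr /= -/(S _).
  have -> : `|i%:R - (i.+1 + m)%:R| = m.+1%:R :> R.
    by rewrite distrC -natrB ?normr_nat addSnnS ?addKn // leq_addr.
  have := tele m.+1%:R; rewrite ltr0n => /(_ isT).
  by rewrite natr1 => h; apply: le_trans (lerD IH h) _; rewrite addrA subrK.
have [Bi|iB] := leqP B i.
  apply: le_trans (below B Bi) _; apply: (@le_trans _ _ 1); last lra.
  by rewrite invf_le1 ?lerDr // ltr_wpDl.
rewrite -/(S B) -(subnKC iB); apply: le_trans (above _) _.
by rewrite lerBlDr lerDl invr_ge0.
Qed.

Lemma pow9E n : 9 ^+ n = 3 ^+ n * 3 ^+ n :> R.
Proof. by rewrite -exprMn; congr (_ ^+ n); ring. Qed.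

Lemma continuous_power n : continuous (power c n).
Proof.
have -> : power c n = fun t => 9 ^- n *
    \sum_(u <- words n) \sum_(v <- words n) cos (t * (pos c u - pos c v)).
  by apply/funext => t; exact: power_pairs.
apply: (@continuous_mul _ (fun=> 9 ^- n)); first exact: cst_continuous.
by do 2!(apply: continuous_bigsum => ?); exact: continuous_cos_scale.
Qed.

Lemma continuous_weighted_power T n :
  continuous (fun t => (1 + - T^-1 * t) * power c n t).
Proof. apply: continuous_mul; [exact: continuous_affine|exact: continuous_power]. Qed.

Lemma integ_weighted_power T n :
  integ 0 T (fun t => (1 + - T^-1 * t) * power c n t) =
  9 ^- n * \sum_(u <- words n) \sum_(v <- words n) fejer T (pos c u - pos c v).
Proof.
have -> : (fun t => (1 + - T^-1 * t) * power c n t) = fun t => 9 ^- n *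
    \sum_(u <- words n) \sum_(v <- words n)
      (1 + - T^-1 * t) * cos (t * (pos c u - pos c v)).
  apply/funext => t; rewrite power_pairs mulrCA mulr_sumr; congr (_ * _).
  by apply: eq_bigr => u _; rewrite mulr_sumr.
rewrite integZ; last first.
  by do 2!(apply: continuous_bigsum => ?); exact: continuous_fejer.
congr (_ * _); rewrite integ_sum => [|u]; last first.
  by apply: continuous_bigsum => ?; exact: continuous_fejer.
by apply: eq_bigr => u _; rewrite integ_sum => // v; exact: continuous_fejer.
Qed.

Lemma weight_itv T t : 0 < T -> 0 <= t <= T -> 0 <= 1 + - T^-1 * t <= 1.
Proof.
move=> T0 /andP[t0 tT]; rewrite mulNr subr_ge0 ler_pdivrMl // mulr1 tT /=.
by rewrite gerBl mulr_ge0 // invr_ge0 ltW.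
Qed.

(** The triangle weight is at most 1 and has a nonnegative Fourier transform, so
    the 3^n diagonal pairs give a lower bound. *)
Lemma integ_power_ge T n : 0 < T -> 3 ^- n * (T / 2) <= integ 0 T (power c n).
Proof.
move=> T0; apply: (@le_trans _ _ (integ 0 T (fun t => (1 + - T^-1 * t) * power c n t))).
  rewrite integ_weighted_power.
  have -> : 3 ^- n * (T / 2) = 9 ^- n * \sum_(u <- words n) (T / 2) :> R.
    rewrite sum_words_const pow9E; field.
    by rewrite expf_neq0.
  rewrite ler_wpM2l ?invr_ge0 ?exprn_ge0 // big_seq [leRHS]big_seq.
  apply: ler_sum => u hu; rewrite (big_rem u) //= subrr fejer0 // lerDl.
  by apply: sumr_ge0 => v _; exact: fejer_ge0.
apply: integ_le; [exact: continuous_weighted_power|exact: continuous_power|].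
move=> t /(weight_itv T0) /andP[_ w1].
by rewrite ler_piMl // power_ge0.
Qed.

(** With T = 3^n, on [0, T] the triangle weight of [0, 2T] is at least 1/2.  After expanding over
    pairs, its transform at the difference of two points decays quadratically in
    the distance of their cells, and [schur_test] reduces the sum to pairs in a
    common cell. *)
Lemma integ_power_le n :
  integ 0 (3 ^+ n) (power c n) <= 54 * (3 ^- n * near_pairs c n).
Proof.
set T : R := 3 ^+ n; have T0 : 0 < T by rewrite exprn_gt0.
have T20 : 0 < 2 * T by rewrite mulr_gt0.
have T2 : T <= 2 * T by lra.
pose wt t : R := 1 + - (2 * T)^-1 * t.
have cw : continuous (fun t => 2 * (wt t * power c n t)).
  apply: (@continuous_mul _ (fun=> 2)); first exact: cst_continuous.
  exact: continuous_weighted_power.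
apply: (@le_trans _ _ (integ 0 T (fun t => 2 * (wt t * power c n t)))).
  apply: integ_le; [exact: continuous_power|exact: cw|].
  move=> t /andP[t0 tT]; have := power_ge0 c n t.
  have : 1 / 2 <= wt t.
    have h : (2 * T)^-1 * t <= 1 / 2 by rewrite ler_pdivrMl //; lra.
    by rewrite /wt mulNr; lra.
  nra.
apply: (@le_trans _ _ (integ 0 (2 * T) (fun t => 2 * (wt t * power c n t)))).
  rewrite (integ_cat cw (ltW T0) T2) lerDl; apply: integ_ge0 => t /andP[tT t2].
  have ht : 0 <= t <= 2 * T by rewrite t2 (le_trans (ltW T0) tT).
  have /andP[w0 _] := weight_itv T20 ht.
  by apply: mulr_ge0 => //; apply: mulr_ge0 => //; exact: power_ge0.
rewrite integZ; last exact: continuous_weighted_power.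
rewrite integ_weighted_power.
pose G (i j : nat) : R := 9 * ((1 + `|i%:R - j%:R|) ^+ 2)^-1.
have key : \sum_(u <- words n) \sum_(v <- words n) fejer (2 * T) (pos c u - pos c v)
   <= T * (27 * near_pairs c n).
  apply: (@le_trans _ _ (T * \sum_(u <- words n) \sum_(v <- words n)
      G (cell c n u) (cell c n v))).
    rewrite mulr_sumr; apply: ler_sum => u _; rewrite mulr_sumr; apply: ler_sum => v _.
    have := cell_itv c_le1 n u; have := cell_itv c_le1 n v.
    rewrite /G; set i : R := (cell c n u)%:R; set j : R := (cell c n v)%:R.
    rewrite -/T => /andP[v1 v2] /andP[u1 u2].
    have D0 : 0 <= `|i - j| by [].
    have P0 : 0 < (1 + `|i - j|) ^+ 2 by rewrite exprn_gt0 //; lra.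
    have [h|h] := leP `|i - j| 2.
      apply: le_trans (fejer_le_half _ T20) _.
      rewrite mulrAC divff // mul1r -[leLHS]mulr1 ler_wpM2l ?(ltW T0) //.
      by rewrite ler_pdivlMr // mul1r; nra.
    have Z : `|i - j| - 1 <= T * `|pos c u - pos c v|.
      rewrite -(gtr0_norm T0) -normrM lerBlDr.
      have -> : i - j = T * (pos c u - pos c v) + (i - j - T * (pos c u - pos c v)) by ring.
      apply: le_trans (ler_normD _ _) _; rewrite lerD2l ler_norml.
      by apply/andP; split; lra.
    have y0 : pos c u - pos c v != 0.
      by apply: contraTneq Z => ->; rewrite normr0 mulr0 -ltNge; lra.
    apply: le_trans (fejer_le_inv T20 y0) _.
    have -> : 2 / (2 * T * (pos c u - pos c v) ^+ 2) =
        T * ((T * `|pos c u - pos c v|) ^+ 2)^-1.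
      rewrite exprMn real_normK ?num_real //; field.
      by rewrite y0 gt_eqF.
    rewrite ler_wpM2l ?(ltW T0) // -[9]invrK -invfM lef_pV2 ?posrE.
    - apply: (@le_trans _ _ ((`|i - j| - 1) ^+ 2)); first nra.
      by rewrite lerXn2r ?nnegrE //; lra.
    - by rewrite exprn_gt0 //; lra.
    - by rewrite mulr_gt0 ?invr_gt0.
  rewrite ler_wpM2l ?(ltW T0) //.
  apply: (le_trans (schur_test (M := 27) _ (cell_lt c_le1 n) _ _ _)).
  - by move=> i j; rewrite mulr_ge0 // invr_ge0 sqr_ge0.
  - by move=> i; rewrite -mulr_sumr; have := near_sum_inv_sq_le i (2 * 3 ^ n); lra.
  - move=> j; rewrite -mulr_sumr; have := near_sum_inv_sq_le j (2 * 3 ^ n).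
    by under eq_bigr do rewrite distrC; lra.
  by rewrite ler_wpM2l // sum_cells_le.
apply: (@le_trans _ _ (2 * (9 ^- n * (T * (27 * near_pairs c n))))).
  by rewrite !ler_wpM2l ?invr_ge0 ?exprn_ge0.
rewrite le_eqVlt; apply/orP; left; apply/eqP.
rewrite /T pow9E; field.
by rewrite expf_neq0.
Qed.

(** At frequencies below 1 the phases are at most 1/2, since the points lie in
    [-1/2, 1/2]; all cosines are then at least 7/8. *)
Lemma power_ge_half n t : `|t| <= 1 -> 1 / 2 <= power c n t.
Proof.
move=> t1; have cs : 7 / 8 * 3 ^+ n <= cos_sum c n t.
  rewrite mulrC -sum_words_const; apply: ler_sum => w _.
  have h : `|t * pos c w| <= 1 / 2.
    by rewrite normrM; have := pos_half c_le1 w; have := normr_ge0 (pos c w); nra.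
  have := one_sub_cos_le (t * pos c w).
  have : (t * pos c w) ^+ 2 <= 1 / 4.
    by rewrite -real_normK ?num_real //; have := normr_ge0 (t * pos c w); nra.
  lra.
rewrite /power ler_pdivlMr ?exprn_gt0 //.
rewrite pow9E.
have := sqr_ge0 (sin_sum c n t); have : 0 < 3 ^+ n :> R by rewrite exprn_gt0.
move: (3 ^+ n) (cos_sum c n t) (sin_sum c n t) cs => X C S; nra.
Qed.

(** Each frequency block between 3^(m b) and 3^(m (b+1)) contributes at least
    d * 729^-m / 4: coarse letters have large mean energy there, the m letters of
    the block are controlled by [power_lower], and finer letters by
    [power_ge_half].  The B contributions add up to at most the bound on the
    whole integral. *)
Lemma energy_dichotomy (d K : R) m B : 0 < d -> d <= 1 -> 1 <= K ->
  218 * K <= 3 ^+ m ->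
  (forall u, 0 <= u <= 3 ^+ m -> d <= symbol c u) ->
  (forall n, (n <= m * B)%N -> near_pairs c n <= 2 * K * 3 ^+ n) ->
  B%:R * (d * 729 ^- m) <= 432 * K.
Proof.
move=> d0 d1 K1 mK hs hE; set e := d * 729 ^- m.
have c0 : 0 < 729 :> R by rewrite ltr0n.
have r0 : 0 < 729 ^- m :> R by rewrite invr_gt0 (exprn_gt0 m c0).
have e0 : 0 < e by rewrite /e (mulr_gt0 d0 r0).
have upper n : (n <= m * B)%N -> integ 0 (3 ^+ n) (power c n) <= 108 * K.
  move=> /hE h; apply: le_trans (integ_power_le n) _.
  rewrite mulrCA mulrC ler_pdivrMr ?exprn_gt0 //; lra.
pose P := power c (m * B); have cP := @continuous_power (m * B).
have le3 i j : (i <= j)%N -> 3 ^+ i <= 3 ^+ j :> R.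
  by move=> ij; rewrite ler_weXn2l // ler1n.
have p3 i : 0 < 3 ^+ i :> R by rewrite exprn_gt0.
have block b : (b < B)%N -> e / 4 <= integ (3 ^+ (m * b)) (3 ^+ (m * b.+1)) P.
  move=> bB; set n' := (m * b)%N; set n := (m * b.+1)%N.
  have nE : n = (n' + m)%N by rewrite /n mulnS addnC.
  have nN : (n <= m * B)%N by rewrite leq_mul2l bB orbT.
  have n'n : (n' <= n)%N by rewrite nE leq_addr.
  apply: (@le_trans _ _ (integ (3 ^+ n') (3 ^+ n) (fun t => e / 4 * power c n' t))).
    rewrite integZ; last exact: continuous_power.
    rewrite -[leLHS]mulr1; apply: ler_wpM2l; first by rewrite divr_ge0 // ltW.
    have := integ_cat (@continuous_power n') (ltW (p3 n')) (le3 _ _ n'n).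
    have := upper n' (leq_trans n'n nN).
    have := integ_power_ge n' (p3 n).
    have -> : 3 ^- n' * (3 ^+ n / 2) = 3 ^+ m / 2 :> R.
      by rewrite nE exprD; field; rewrite expf_neq0.
    lra.
  apply: integ_le; [|exact: cP|].
    apply: (@continuous_mul _ (fun=> e / 4)); first exact: cst_continuous.
    exact: continuous_power.
  move=> t /andP[tn' tn].
  have t0 : 0 <= t by apply: le_trans tn'; rewrite ltW.
  rewrite /P -(subnKC nN) power_cat [in X in _ <= X * _]nE power_cat.
  have a1 : 1 / 2 <= power c (m * B - n) (3 ^- n * t).
    apply: power_ge_half; rewrite ger0_norm; last by rewrite mulr_ge0 // invr_ge0 ltW.
    by rewrite ler_pdivrMl // mulr1.
  have a2 : e / 2 <= power c m (3 ^- n' * t).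
    apply: power_lower => //; apply/andP; split.
      by rewrite mulr_ge0 // invr_ge0 ltW.
    by rewrite ler_pdivrMl // -exprD -nE.
  have a0 := power_ge0 c n' t.
  move: a1 a2 a0; move: (power c _ _) (power c _ _) (power c _ _) => x y z h1 h2 h3.
  have h4 : e / 4 <= z * y by nra.
  have := ler_wpM2l h3 h4; lra.
have sum b : (b <= B)%N -> b%:R * (e / 4) <= integ 0 (3 ^+ (m * b)) P.
  elim: b => [|b IH] bB.
    by rewrite mul0r; apply: integ_ge0 => t _; exact: power_ge0.
  have mb : (m * b <= m * b.+1)%N by rewrite leq_mul2l leqnSn orbT.
  rewrite (integ_cat cP (ltW (p3 (m * b)%N)) (le3 _ _ mb)).
  have := IH (ltnW bB); have := block b bB; rewrite -natr1; lra.
have := sum B (leqnn B); have := upper (m * B)%N (leqnn _); rewrite /P; lra.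
Qed.

End PowerIntegral.

(** * Small values of sinusoids *)

Section Angles.
Context {R : realType}.
Implicit Types (A B x y th eps del : R).

Lemma abs_sin_addn_pi x n : `|sin (x + n%:R * pi)| = `|sin x|.
Proof.
elim: n => [|n IH]; first by rewrite mul0r addr0.
by rewrite -natr1 mulrDl mul1r addrA sinDpi normrN.
Qed.

Lemma abs_sin_sub_int_pi x (k : int) : `|sin (x - k%:~R * pi)| = `|sin x|.
Proof.
case: k => n; last by rewrite NegzE mulrNz mulNr opprK abs_sin_addn_pi.
by rewrite -[in RHS](subrK (n%:R * pi) x) abs_sin_addn_pi.
Qed.

Lemma dist_int_pi_le x : exists k : int, `|x - k%:~R * pi| <= 3 * `|sin x|.
Proof.
have p0 : 0 < pi :> R := pi_gt0 R.
exists (Num.floor (x / pi + 1 / 2)); set k := Num.floor _.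
rewrite -(abs_sin_sub_int_pi x k); set r := x - _.
have r2 : `|r| <= 2.
  have /andP[h1 h2] : k%:~R <= x / pi + 1 / 2 < k%:~R + 1.
    by have := floor_itv (x / pi + 1 / 2); rewrite intrD.
  have -> : r = (x / pi - k%:~R) * pi by rewrite /r mulrBl divfK // gt_eqF.
  have q2 : `|x / pi - k%:~R| <= 1 / 2 by rewrite ler_norml; apply/andP; split; lra.
  rewrite normrM (gtr0_norm p0); apply: le_trans (ltW (pihalf_lt2 R)).
  by rewrite mulrC ler_wpM2l ?(ltW p0) // -[2^-1]mul1r.
have [r0|r0] := leP 0 r.
  have h := @sin_ge_third R r; rewrite r0 -(ger0_norm r0) r2 in h.
  have {}h := h isT; rewrite (ger0_norm r0) in h *.
  by have := ler_norm (sin r); lra.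
have h := @sin_ge_third R (- r); rewrite oppr_ge0 (ltW r0) -(ltr0_norm r0) r2 in h.
have {}h := h isT; rewrite (ltr0_norm r0) sinN in h *.
by have := ler_norm (- sin r); rewrite normrN; lra.
Qed.

Lemma coverable_seq (I : eqType) (s : seq I) (A : I -> R -> Prop) (l : R) :
  (forall i, i \in s -> coverable (A i) l) ->
  coverable (fun x => exists2 i, i \in s & A i x) ((size s)%:R * l).
Proof.
elim: s => [|i s IH] h.
  by exists [::]; split => //; [move=> x [] | rewrite big_nil mul0r].
have [t [t0 tA tl]] := h i (mem_head _ _).
have [|t' [t0' tA' tl']] := IH; first by move=> j js; apply: h; rewrite inE js orbT.
exists (t ++ t'); split.
- by move=> p; rewrite mem_cat => /orP[/t0|/t0'].
- move=> x [j]; rewrite inE => /predU1P[-> /tA [p pt hp]|js Ax].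
    by exists p => //; rewrite mem_cat pt.
  have [|p pt hp] := tA' x; first by exists j.
  by exists p => //; rewrite mem_cat pt orbT.
- by rewrite big_cat /= -[(size s).+1%:R]natr1 mulrDl mul1r addrC lerD.
Qed.

Definition sinusoid A B th : R := A * cos th + B * sin th.

(** Two zeros of a sinusoid of amplitude at least 1 are a multiple of pi apart, and
    its slope near a zero is bounded below: hence within distance 1 the sublevel
    set has small diameter. *)
Lemma sinusoid_small_close A B eps x y : 1 <= A ^+ 2 + B ^+ 2 -> eps <= 1 / 2 ->
  `|x - y| <= 1 -> `|sinusoid A B x| <= eps -> `|sinusoid A B y| <= eps ->
  `|y - x| <= 12 * eps.
Proof.
move=> AB e2 xy gx gy; have e0 : 0 <= eps by apply: le_trans gx.
(* g' is the derivative of the sinusoid at x. *)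
pose g' := B * cos x - A * sin x.
have gg : sinusoid A B x ^+ 2 + g' ^+ 2 = A ^+ 2 + B ^+ 2.
  have -> : A ^+ 2 + B ^+ 2 = (A ^+ 2 + B ^+ 2) * (cos x ^+ 2 + sin x ^+ 2).
    by rewrite cos2Dsin2 mulr1.
  by rewrite /sinusoid /g'; ring.
have g'2 : 1 / 2 <= `|g'|.
  have gx2 : sinusoid A B x ^+ 2 <= 1 / 4.
    by rewrite -real_normK ?num_real //; have := normr_ge0 (sinusoid A B x); nra.
  rewrite leNgt; apply/negP => h.
  have : g' ^+ 2 < 1 / 4.
    by rewrite -real_normK ?num_real //; have := normr_ge0 g'; nra.
  lra.
have e : sinusoid A B y = sinusoid A B x * cos (y - x) + g' * sin (y - x).
  rewrite /sinusoid -[in LHS](subrK x y); move: (y - x) => r.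
  by rewrite cosD sinD /g'; ring.
have s4 : `|sin (y - x)| <= 4 * eps.
  have h : `|g' * sin (y - x)| <= 2 * eps.
    rewrite (_ : g' * _ = sinusoid A B y - sinusoid A B x * cos (y - x)); last by rewrite e; ring.
    apply: le_trans (ler_normB _ _) _; rewrite normrM.
    have := cos_max (y - x); have := normr_ge0 (sinusoid A B x); nra.
  by move: h; rewrite normrM; have := normr_ge0 (sin (y - x)); nra.
rewrite distrC in xy; move: s4 xy; move: (y - x) => r s4 r1.
have [r0|r0] := leP 0 r.
  have h := @sin_ge_third R r; rewrite ger0_norm // in r1 *.
  have : 0 <= r <= 2 by apply/andP; split => //; lra.
  by move/h; have := ler_norm (sin r); lra.
have h := @sin_ge_third R (- r); rewrite ltr0_norm // in r1 *.
have : 0 <= - r <= 2 by apply/andP; split; lra.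
by move/h; have := ler_norm (- sin r); rewrite sinN normrN; lra.
Qed.

Lemma coverable_sinusoid A B eps : 1 <= A ^+ 2 + B ^+ 2 -> 0 < eps -> eps <= 1 / 2 ->
  coverable (fun th => 0 <= th <= 4 /\ `|sinusoid A B th| <= eps) (104 * eps).
Proof.
move=> AB e0 e2.
have piece (i : nat) : coverable
    (fun th => i%:R <= th <= i%:R + 1 /\ `|sinusoid A B th| <= eps) (26 * eps).
  have [[x [/andP[x1 x2] gx]]|no] := pselect (exists x,
      i%:R <= x <= i%:R + 1 /\ `|sinusoid A B x| <= eps); last first.
    exists [::]; split => //; last by rewrite big_nil mulr_ge0 // ltW.
    by move=> x hx; case: no; exists x.
  exists [:: (x, 13 * eps)]; split.
  - by move=> p; rewrite inE => /eqP -> /=; rewrite mulr_ge0 // ltW.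
  - move=> y [/andP[y1 y2] gy]; exists (x, 13 * eps); rewrite ?inE //=.
    apply: le_lt_trans (sinusoid_small_close AB e2 _ gx gy) _; last by lra.
    by rewrite ler_norml; apply/andP; split; lra.
  - by rewrite big_seq1 /=; lra.
have := @coverable_seq _ (iota 0 4) _ _ (fun i _ => piece i).
apply: coverable_le; last by rewrite size_iota; lra.
move=> th [/andP[t0 t4] g].
have tr := truncn_itv t0; set i := Num.truncn th in tr.
have /andP[h1 h2] := tr.
have [hi|hi] := ltnP i 4.
  by exists i; rewrite ?mem_iota //; split => //; rewrite h1 natr1 ltW.
have : 4 <= i%:R :> R by rewrite ler_nat.
by exists 3%N => //; split => //; apply/andP; split; lra.
Qed.

End Angles.

(** * Resonant angles are rare *)

Section Directions.
Context {R : realType}.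
Implicit Types (th u del : R) (k l : int).

Definition phase (a : 'I_3) : R := pi * (2^-1 + 2 / 3 * ((a : nat)%:R - 1)).
(** The orthogonal projection of the unit vector of argument [phase a] to the line
    at angle [th]. *)
Definition dir th (a : 'I_3) : R := cos (phase a - th).

Lemma dir_le1 th a : `|dir th a| <= 1.
Proof. exact: cos_max. Qed.

(** The triple angle formula at pi / 3 factors as (C + 1) (2 C - 1)^2 = 0. *)
Lemma cos_pi_third : cos (pi / 3) = 1 / 2 :> R.
Proof.
have := cos_triple (pi / 3 : R); have -> : 3 * (pi / 3) = pi :> R by field.
have p0 := pi_gt0 R.
have c0 : 0 < cos (pi / 3) :> R by apply: cos_gt0_pihalf; apply/andP; split; lra.
rewrite cospi; move: (cos _) c0 => C C0 h.
have /eqP : (C + 1) * (2 * C - 1) ^+ 2 = 0.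
  have -> : (C + 1) * (2 * C - 1) ^+ 2 = 4 * C ^+ 3 - 3 * C + 1 by ring.
  by rewrite -h; lra.
rewrite mulf_eq0 sqrf_eq0 gt_eqF /=; last lra.
by move=> /eqP; lra.
Qed.

Lemma cos_phase_sub (i j : 'I_3) : i != j -> cos (phase i - phase j) = - 1 / 2.
Proof.
have c2 : cos (2 * (pi / 3)) = - 1 / 2 :> R.
  have -> : 2 * (pi / 3) = pi / 3 + pi / 3 :> R by ring.
  have := cos2Dsin2 (pi / 3 : R); rewrite cosD cos_pi_third => h; lra.
have c4 : cos (4 * (pi / 3)) = - 1 / 2 :> R.
  have -> : 4 * (pi / 3) = 2 * (pi / 3) + 2 * (pi / 3) :> R by ring.
  have := cos2Dsin2 (2 * (pi / 3) : R); rewrite cosD c2 => h; lra.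
have e : phase i - phase j = (2 * (i : nat)%:R - 2 * (j : nat)%:R) * (pi / 3).
  by rewrite /phase; field.
rewrite e; case: i j {e} => [[|[|[|//]]] Hi] [[|[|[|//]]] Hj] //= _.
- by rewrite -[RHS]c2 -cosN; congr cos; ring.
- by rewrite -[RHS]c4 -cosN; congr cos; ring.
- by rewrite -[RHS]c2; congr cos; ring.
- by rewrite -[RHS]c2 -cosN; congr cos; ring.
- by rewrite -[RHS]c4; congr cos; ring.
- by rewrite -[RHS]c2; congr cos; ring.
Qed.

Definition i2 : 'I_3 := inord 2.

(** The cosine and sine coefficients, as functions of the angle, of the linear
    form that nearly vanishes at a resonance; see [resonanceE]. *)
Definition res_cos k l : R :=
  l%:~R * (cos (phase 0) - cos (phase 1)) - k%:~R * (cos (phase 1) - cos (phase i2)).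
Definition res_sin k l : R :=
  l%:~R * (sin (phase 0) - sin (phase 1)) - k%:~R * (sin (phase 1) - sin (phase i2)).

Lemma resonanceE k l th :
  sinusoid (res_cos k l) (res_sin k l) th =
  l%:~R * (dir th 0 - dir th 1) - k%:~R * (dir th 1 - dir th i2).
Proof. by rewrite /sinusoid /dir !cosB /res_cos /res_sin; ring. Qed.

(** The squared amplitude is that of the vector l (e0 - e1) - k (e1 - e2), where
    e0, e1, e2 are unit vectors at mutual angles 2 pi / 3; it equals
    3 (l^2 + l k + k^2). *)
Lemma resonance_amplitude k l : k != 0 ->
  1 <= res_cos k l ^+ 2 + res_sin k l ^+ 2.
Proof.
move=> k0.
have h01 : cos (phase 0 - phase 1) = - 1 / 2 by apply: cos_phase_sub.
have h12 : cos (phase 1 - phase i2) = - 1 / 2.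
  by apply: cos_phase_sub; rewrite -val_eqE /= inordK.
have h02 : cos (phase 0 - phase i2) = - 1 / 2.
  by apply: cos_phase_sub; rewrite -val_eqE /= inordK.
rewrite !cosB in h01 h12 h02.
have := cos2Dsin2 (phase 0); have := cos2Dsin2 (phase 1); have := cos2Dsin2 (phase i2).
rewrite /res_cos /res_sin.
have k1 : 1 <= k%:~R ^+ 2 :> R.
  have : (1 <= k ^+ 2)%R by rewrite -gtz0_ge1 exprn_even_gt0.
  by rewrite -(ler_int R) rmorphXn.
move: (cos (phase 0)) (sin (phase 0)) (cos (phase 1)) (sin (phase 1))
  (cos (phase i2)) (sin (phase i2)) h01 h12 h02 => a a' b b' c c' h01 h12 h02 hc hb ha.
move: (k%:~R) (l%:~R) k1 => x y k1.
have -> : (y * (a - b) - x * (b - c)) ^+ 2 + (y * (a' - b') - x * (b' - c')) ^+ 2 =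
   y ^+ 2 * ((a ^+ 2 + a' ^+ 2) + (b ^+ 2 + b' ^+ 2) - 2 * (a * b + a' * b')) +
   x ^+ 2 * ((b ^+ 2 + b' ^+ 2) + (c ^+ 2 + c' ^+ 2) - 2 * (b * c + b' * c')) -
   2 * x * y * ((a * b + a' * b') - (a * c + a' * c') - (b ^+ 2 + b' ^+ 2) + (b * c + b' * c')).
  by ring.
rewrite ha hb hc h01 h12 h02; have := sqr_ge0 (x + 2 * y); nra.
Qed.

Lemma phase_diff_near_int_pi del (x y z : R) : 0 <= del ->
  phase_sum2 x y z <= 9 * del ^+ 2 ->
  exists k : int, `|3 / 2 * (x - y) - k%:~R * pi| <= 48 * del.
Proof.
move=> d0 h; have [k hk] := dist_int_pi_le (3 / 2 * (x - y)).
exists k; apply: le_trans hk _.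
have : sin (3 / 2 * (x - y)) ^+ 2 <= (16 * del) ^+ 2.
  have := one_sub_cos_triple_le x y z.
  have -> : 3 * (x - y) = 3 / 2 * (x - y) + 3 / 2 * (x - y) by field.
  have := cos2Dsin2 (3 / 2 * (x - y)); rewrite cosD; nra.
rewrite -real_normK ?num_real // ler_pXn2r ?nnegrE //; first lra.
by rewrite mulr_ge0.
Qed.

(** When [symbol] is tiny, 3/2 times both phase differences are near multiples
    k pi and l pi, with k nonzero because the phases are far from aligned.
    Eliminating [u] from the two relations leaves a linear relation between the
    two digit differences alone. *)
Lemma small_symbol_resonance (M : R) th u del : 0 < del -> del <= 1 / 64 -> 1 <= M ->
  0 <= u <= M -> symbol (dir th) u < del ^+ 2 ->
  exists k l, [/\ k != 0, `|k%:~R| <= 2 * M, `|l%:~R| <= 2 * M &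
    `|l%:~R * (dir th 0 - dir th 1) - k%:~R * (dir th 1 - dir th i2)|
      <= 384 * del * M].
Proof.
move=> d0 d1 M1 /andP[u0 uM]; rewrite symbolE -/i2.
set X := dir th 0; set Y := dir th 1; set Z := dir th i2.
rewrite ltr_pdivrMr // => hs.
have hs1 : phase_sum2 (u * X) (u * Y) (u * Z) <= 9 * del ^+ 2 by lra.
have hs2 : phase_sum2 (u * Y) (u * Z) (u * X) <= 9 * del ^+ 2.
  by rewrite -phase_sum2_rot.
have [k hk] := phase_diff_near_int_pi (ltW d0) hs1.
have [l hl] := phase_diff_near_int_pi (ltW d0) hs2.
have bd (a b : R) : `|a| <= 1 -> `|b| <= 1 -> `|u * a - u * b| <= 2 * M.
  move=> a1 b1; rewrite -mulrBr normrM (ger0_norm u0).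
  by have := ler_normB a b; have := normr_ge0 (a - b); nra.
have bXY := bd _ _ (dir_le1 th 0) (dir_le1 th 1).
have bYZ := bd _ _ (dir_le1 th 1) (dir_le1 th i2).
have p2 := pi_ge2 R.
have int_bd (j : int) (x : R) : `|x| <= 2 * M ->
    `|3 / 2 * x - j%:~R * pi| <= 48 * del -> `|j%:~R| <= 2 * M :> R.
  move=> xM hj; have h : `|j%:~R * pi| <= 4 * M.
    have -> : j%:~R * pi = 3 / 2 * x - (3 / 2 * x - j%:~R * pi) by ring.
    apply: le_trans (ler_normB _ _) _; rewrite normrM ger0_norm //; lra.
  move: h; rewrite normrM (gtr0_norm (pi_gt0 R)); have := normr_ge0 (j%:~R : R); nra.
have kM := int_bd _ _ bXY hk; have lM := int_bd _ _ bYZ hl.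
have k0 : k != 0.
  apply/eqP => k0; rewrite k0 mul0r subr0 in hk.
  have := phase_near_third (u * X) (u * Y) (u * Z).
  have := one_sub_cos_le (u * X - u * Y).
  move: hk; rewrite normrM ger0_norm // => hk.
  have : (u * X - u * Y) ^+ 2 <= 1 / 4.
    rewrite -real_normK ?num_real //; have := normr_ge0 (u * X - u * Y); nra.
  have : del ^+ 2 <= 1 / 4096 by nra.
  nra.
exists k, l; split => //.
(* A nonzero k forces u away from 0, so that dividing by u is harmless. *)
have ge : 1 / 3 <= u.
  have k1 : 1 <= `|k%:~R| :> R.
    by rewrite -intr_norm -[1]/(1%:~R) ler_int -gtz0_ge1 normr_gt0.
  have : `|k%:~R * pi| <= 3 * u + 48 * del.
    have -> : k%:~R * pi = 3 / 2 * (u * X - u * Y) - (3 / 2 * (u * X - u * Y) - k%:~R * pi) by ring.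
    apply: le_trans (ler_normB _ _) _; apply: lerD => //.
    rewrite -mulrBr normrM ger0_norm // normrM (ger0_norm u0).
    have XY : `|X - Y| <= 2.
      have := ler_normB X Y; have := dir_le1 th 0; have := dir_le1 th 1.
      by rewrite -/X -/Y; lra.
    by have := ler_wpM2l u0 XY; lra.
  rewrite normrM (gtr0_norm (pi_gt0 R)).
  have : pi <= `|k%:~R| * pi :> R by rewrite ler_peMl // pi_ge0.
  lra.
set E := l%:~R * (X - Y) - _.
have : u * (3 / 2) * `|E| <= 192 * del * M.
  rewrite -(ger0_norm (_ : 0 <= u * (3 / 2))) -?normrM; last by rewrite mulr_ge0.
  have -> : u * (3 / 2) * E = l%:~R * (3 / 2 * (u * X - u * Y) - k%:~R * pi)
     - k%:~R * (3 / 2 * (u * Y - u * Z) - l%:~R * pi) by rewrite /E; ring.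
  apply: le_trans (ler_normB _ _) _; rewrite !normrM.
  have h1 := ler_pM (normr_ge0 (l%:~R : R)) (normr_ge0 _) lM hk.
  have h2 := ler_pM (normr_ge0 (k%:~R : R)) (normr_ge0 _) kM hl.
  by apply: le_trans (lerD h1 h2) _; lra.
have := normr_ge0 E; nra.
Qed.

Definition int_range n : seq int := [seq (a%:Z - n%:Z)%R | a <- iota 0 (2 * n).+1].

Lemma mem_int_range n (k : int) : `|k%:~R| <= n%:R :> R -> k \in int_range n.
Proof.
rewrite -intr_norm -[n%:R]/(n%:Z%:~R) ler_int ler_norml => /andP[h1 h2].
have kn : 0 <= k + n%:Z by lia.
apply/mapP; exists (absz (k + n%:Z)); last by rewrite gez0_abs ?addrK.
by rewrite mem_iota /=; lia.
Qed.

(** There are at most 25 * 9^m pairs (k, l), each with a sublevel set of length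
    O(del * 3^m).  The exponent of [del] makes the product at most 3^-m, with
    3^13 absorbing the numerical constants. *)
Lemma coverable_bad_angles m (del : R) : del = 3 ^- (4 * m + 13) ->
  coverable (fun th => 0 <= th <= pi /\
    exists2 u, 0 <= u <= 3 ^+ m & symbol (dir th) u < del ^+ 2) (3 ^- m).
Proof.
move=> dE; set M : R := 3 ^+ m; set eps := 384 * del * M.
have M1 : 1 <= M by rewrite exprn_ege1 // ler1n.
have d0 : 0 < del by rewrite dE invr_gt0 exprn_gt0.
have dM : del * M ^+ 4 = (729 * 2187)^-1.
  have -> : 729 * 2187 = 3 ^+ 13 :> R by ring.
  rewrite dE exprD invfM /M -exprM [(m * 4)%N]mulnC mulrAC mulVf ?mul1r //.
clear dE.
have d1 : del * M <= del * M ^+ 4.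
  by rewrite ler_wpM2l ?(ltW d0) // -[leLHS]expr1 ler_weXn2l.
have d2 : del <= del * M by rewrite ler_peMr // ltW.
pose n := (2 * 3 ^ m)%N.
have nE : n%:R = 2 * M by rewrite /n natrM natrX.
pose s := [seq p <- [seq (k, l) | k <- int_range n, l <- int_range n] | p.1 != 0].
have c0 : 0 < 384 :> R by rewrite ltr0n.
have e0 : 0 < eps by exact: mulr_gt0 (mulr_gt0 c0 d0) (lt_le_trans ltr01 M1).
have e2 : eps <= 1 / 2 by rewrite /eps; lra.
have cov p : p \in s -> coverable
    (fun th => 0 <= th <= 4 /\ `|sinusoid (res_cos p.1 p.2) (res_sin p.1 p.2) th| <= eps)
    (104 * eps).
  rewrite mem_filter => /andP[k0 _]; apply: coverable_sinusoid => //.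
  exact: resonance_amplitude.
apply: coverable_le (coverable_seq cov).
  move=> th [/andP[t0 tpi] [u hu su]].
  have [|k [l [k0 kM lM res]]] := small_symbol_resonance d0 _ M1 hu su; first by lra.
  exists (k, l).
    rewrite mem_filter k0; apply/allpairsP; exists (k, l).
    by split => //; apply: mem_int_range; rewrite nE.
  split; last by rewrite resonanceE.
  by rewrite t0; have := pihalf_lt2 R; lra.
have sz : (size s)%:R <= 25 * M ^+ 2.
  apply: (@le_trans _ _ (((2 * n).+1 * (2 * n).+1)%N%:R)).
    rewrite ler_nat size_filter; apply: leq_trans (count_size _ _) _.
    by rewrite size_allpairs !size_map !size_iota.
  rewrite natrM -natr1 natrM nE; nra.
apply: (@le_trans _ _ (25 * M ^+ 2 * (104 * eps))).
  by rewrite ler_wpM2r // mulr_ge0 // ltW.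
have -> : 25 * M ^+ 2 * (104 * eps) = (25 * 104 * 384) * (del * M ^+ 4) / M.
  by rewrite /eps; field; rewrite gt_eqF //; lra.
have q : 25 * 104 * 384 * (729 * 2187)^-1 <= 1 :> R by lra.
have M0 : 0 <= M^-1 by rewrite invr_ge0; lra.
by have := ler_wpM2r M0 q; rewrite mul1r dM.
Qed.

End Directions.

(** * Short shadows at non-resonant angles *)

Section GoodAngle.
Context {R : realType}.
Implicit Types th : R.

(** Either some level has crowded words of density more than 1 / (24 K N), and
    [coverable_of_rich] applies, or the energies stay below 2K on all N levels,
    which contradicts [energy_dichotomy].  All parameters are powers of 3: the
    offset 5 in the block length gives 3^m >= 218 K, and the exponents of B, N
    and L are the ones at which the inequalities between them close up. *)
Lemma good_angle_cover s n th :
  (3 ^ (34 * s + 217) <= n)%N ->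
  (forall u, 0 <= u <= 3 ^+ (s + 5) ->
     (3 ^- (4 * (s + 5) + 13)) ^+ 2 <= symbol (dir th) u) ->
  coverable (shadow (dir th) n) (26 * 3 ^- s).
Proof.
move=> hn hs; set m := (s + 5)%N in hs; set del : R := 3 ^- _ in hs.
pose K : R := 3 ^+ s; pose N := (3 ^ (16 * s + 107))%N.
pose L := (3 ^ (18 * s + 110))%N; pose B := (3 ^ (15 * s + 102))%N.
have K1 : 1 <= K by rewrite exprn_ege1 // ler1n.
have K0 : 0 < K by lra.
have N0 : 0 < N%:R :> R by rewrite ltr0n expn_gt0.
pose eta : R := (24 * K * N%:R)^-1.
have eta0 : 0 < eta by rewrite invr_gt0 !mulr_gt0.
have NB : (m * B <= N)%N.
  have -> : N = (3 ^ m * B)%N by rewrite /N /B -expnD; congr expn; rewrite /m; lia.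
  by rewrite leq_mul2r ltnW ?orbT // ltn_expl.
have NL : (N * L <= n)%N.
  apply: leq_trans hn; rewrite /N /L -expnD leq_exp2l //; lia.
have [[k /andP[k1 kN] hk]|no] := pselect (exists2 k, (1 <= k <= N)%N &
    3 ^+ k * eta < rich_count (dir th) K k).
  apply: coverable_le (coverable_of_rich (dir_le1 th) K0 eta0 kN _ NL hk) => //;
    last exact: expn_gt0.
  have -> : L%:R * eta = 27 / 24 * K.
    have -> : L%:R = 27 * (K * K * N%:R).
      rewrite /L /K /N !natrX -!exprD (_ : 27 = 3 ^+ 3); last by ring.
      by rewrite -exprD; congr (_ ^+ _); lia.
    by rewrite /eta; field; rewrite !gt_eqF.
  have -> : 24 / K + 2 / (27 / 24 * K) = (24 + 16 / 9) * K^-1.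
    by field; rewrite gt_eqF.
  by rewrite ler_wpM2r ?invr_ge0 ?(ltW K0) //; lra.
exfalso; have rich k : (1 <= k <= N)%N -> rich_count (dir th) K k <= 3 ^+ k * eta.
  by move=> hk; rewrite leNgt; apply/negP => h; apply: no; exists k.
have small : 24 * K * N%:R * eta <= 1.
  by rewrite /eta divff // gt_eqF // !mulr_gt0.
have hE := near_pairs_bound (dir_le1 th) K1 (ltW eta0) small rich.
have del0 : 0 < del by rewrite invr_gt0 exprn_gt0.
have del1 : del <= 1 by rewrite invf_le1 ?exprn_gt0 // exprn_ege1 // ler1n.
have mK : 218 * K <= 3 ^+ m.
  by rewrite /m exprD mulrC ler_wpM2l ?(ltW K0) // (_ : 3 ^+ 5 = 243); [lra|ring].
have := @energy_dichotomy _ _ (dir_le1 th) (del ^+ 2) K m B _ _ K1 mK hs _.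
rewrite exprn_gt0 // exprn_ile1 ?(ltW del0) // => /(_ isT isT) h.
have {}h := h (fun n hn => hE n (leq_trans hn NB)).
have e : B%:R * (del ^+ 2 * 729 ^- m) = 729 * K.
  have -> : B%:R = 729 * K * (3 ^+ (4 * m + 13)) ^+ 2 * 729 ^+ m.
    have key (x : R) a b : x ^+ (6 + s + a * 2 + 6 * b) =
        x ^+ 6 * x ^+ s * (x ^+ a) ^+ 2 * (x ^+ 6) ^+ b 
      by rewrite 3!exprD [x ^+ (a * 2)]exprM [x ^+ (6 * b)]exprM.
    have -> : 729 = 3 ^+ 6 :> R by ring.
    have eB : (15 * s + 102 = 6 + s + (4 * m + 13) * 2 + 6 * m)%N.
      by rewrite /m; clear; lia.
    by rewrite /B natrX eB (key 3 (4 * m + 13)%N m).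
  have X0 : 3 ^+ (4 * m + 13) != 0 :> R by rewrite expf_neq0.
  have Y0 : 729 ^+ m != 0 :> R by apply: expf_neq0; rewrite pnatr_eq0.
  rewrite /del; move: (3 ^+ (4 * m + 13)) (729 ^+ m) X0 Y0 => X Y X0 Y0.
  by field; rewrite ?X0 ?Y0.
rewrite e in h; lra.
Qed.

End GoodAngle.

(** * Measure of a finite union of intervals *)

Section Measure.
Context {R : realType}.
Local Open Scope classical_set_scope.
Notation mu := (@lebesgue_measure R).

(** Lebesgue measure is the restriction of an outer measure defined on all sets, so
    monotonicity holds without measurability. *)
Lemma le_lebesgue (A B : set R) : A `<=` B -> (mu A <= mu B)%E.
Proof. by move=> AB; exact: le_outer_measure. Qed.

Definition ball_union (s : seq (R * R)) : set R :=
  [set x | exists2 p, p \in s & `|x - p.1| < p.2].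

Lemma ball_union_cons p s : ball_union (p :: s) = ball p.1 p.2 `|` ball_union s.
Proof.
apply/seteqP; split => x /=.
  move=> [q]; rewrite inE => /predU1P[->|qs] h; last by right; exists q.
  by left; rewrite /ball /= distrC.
case=> [|[q qs h]]; last by exists q => //; rewrite inE qs orbT.
by rewrite /ball /= distrC => h; exists p; rewrite ?inE ?eqxx.
Qed.

Lemma measurable_ballR (x r : R) : measurable (ball x r).
Proof. by rewrite ball_itv; exact: measurable_itv. Qed.

Lemma measurable_ball_union s : measurable (ball_union s).
Proof.
elim: s => [|p s IH]; last first.
  by rewrite ball_union_cons; apply: measurableU => //; exact: measurable_ballR.
by rewrite (_ : ball_union [::] = set0) //; apply/seteqP; split => x // [].
Qed.

Lemma lebesgue_ball_union s : (forall p, p \in s -> 0 <= p.2) ->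
  (mu (ball_union s) <= (\sum_(p <- s) 2 * p.2)%:E)%E.
Proof.
elim: s => [|p s IH] s0.
  rewrite big_nil (_ : ball_union [::] = set0) ?measure0 //.
  by apply/seteqP; split => x // [].
rewrite ball_union_cons big_cons EFinD.
apply: le_trans (measureU2 _ _ _) _.
- exact: measurable_ballR.
- exact: measurable_ball_union.
apply: leeD; last by apply: IH => q qs; apply: s0; rewrite inE qs orbT.
by rewrite [leLHS](lebesgue_measure_ball _ (s0 p (mem_head _ _))) mulr_natl.
Qed.

End Measure.

(** * Favard length of the gasket *)

Section Favard.
Context {R : realType}.
Local Open Scope classical_set_scope.
Local Open Scope complex_scope.
Notation mu := (@lebesgue_measure R).

Lemma lebesgue_coverable (A : set R) (l : R) : coverable A l -> (mu A <= l%:E)%E.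
Proof.
move=> [s [s0 sA sl]]; apply: (@le_trans _ _ (mu (ball_union s))).
  by apply: le_lebesgue => x /sA.
by apply: le_trans (lebesgue_ball_union s0) _; rewrite lee_fin.
Qed.

(** The integral of a nonnegative function is a supremum over the simple functions
    below it, so it is monotone even where measurability is unknown. *)
Lemma le_integral_of_le (D : set R) (f g : R -> \bar R) :
  (forall x, D x -> (0 <= f x)%E) -> (forall x, D x -> (f x <= g x)%E) ->
  (\int[mu]_(x in D) f x <= \int[mu]_(x in D) g x)%E.
Proof.
move=> f0 fg; rewrite !ge0_integralE //; last first.
  by move=> x Dx; apply: le_trans (f0 x Dx) (fg x Dx).
apply: le_ereal_sup => _ [h hf <-]; exists h => // x; apply: le_trans (hf x) _.
by rewrite /patch; case: ifP => //; rewrite inE => /fg.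
Qed.

Lemma mem_words n w : size w = n -> w \in words n.
Proof.
elim: n w => [|n IH] [|a w] //= [sw].
by apply/allpairsP; exists (a, w); rewrite mem_enum IH.
Qed.

Lemma pos_map_enum (c : 'I_3 -> R) n (g : 'I_n -> 'I_3) :
  pos c [seq g k | k <- enum 'I_n] = \sum_(k < n) 3^-1 ^+ k.+1 * c (g k).
Proof.
elim: n g => [|n IH] g; first by rewrite enum_ord0 big_ord0.
rewrite enum_ordSl /= -map_comp IH big_ord_recl expr1 mulrDl mulrC; congr (_ + _).
rewrite mulr_suml; apply: eq_bigr => k _ /=.
by rewrite [in RHS]exprS /bump /= add1n; ring.
Qed.

Definition digit (j : int) : 'I_3 := inord (absz (j + 1)).

Lemma phase_digit (j : int) : j \in [:: -1; 0; 1] ->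
  phase (digit j) = pi * (2^-1 + 2 / 3 * j%:~R) :> R.
Proof.
rewrite /phase /digit !inE => /or3P[]/eqP->; rewrite inordK //=; congr (_ * (_ + _ * _)).
- by rewrite sub0r.
- by rewrite subrr.
- by rewrite mulr2n addrK.
Qed.

Lemma dotcD (z w v : R[i]) : dotc (z + w) v = dotc z v + dotc w v.
Proof. by case: z w v => [a b] [c d] [e f]; rewrite /dotc /=; ring. Qed.

Lemma dotc_center n (alpha : 'I_n -> int) (th : R) : alpha \in @gasket_index n ->
  dotc (gasket_center alpha) (expi th) =
  pos (dir th) [seq digit (alpha k) | k <- enum 'I_n].
Proof.
rewrite inE => ha; rewrite pos_map_enum /gasket_center.
have -> : dotc (\sum_(k < n) ((3^-1 : R) ^+ k.+1)%:C *
      expi (pi * (2^-1 + 2 / 3 * (alpha k)%:~R))) (expi th) =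
    \sum_(k < n) dotc (((3^-1 : R) ^+ k.+1)%:C *
      expi (pi * (2^-1 + 2 / 3 * (alpha k)%:~R))) (expi th).
  apply: (big_morph (fun z => dotc z (expi th))) => [z w|]; first exact: dotcD.
  by rewrite /dotc /= !mul0r addr0.
apply: eq_bigr => k _; rewrite /dir phase_digit //.
by rewrite cosB /dotc /expi /=; ring.
Qed.

Lemma dotc_expi_le (z : R[i]) (r th : R) : `|z| < r%:C -> `|dotc z (expi th)| < r.
Proof.
rewrite normc_def ltcR; apply: le_lt_trans.
case: z => a b; rewrite /dotc /expi /=.
rewrite -[leLHS]sqrtr_sqr ler_sqrt ?addr_ge0 ?sqr_ge0 //.
have -> : a ^+ 2 + b ^+ 2 = (a ^+ 2 + b ^+ 2) * (cos th ^+ 2 + sin th ^+ 2).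
  by rewrite cos2Dsin2 mulr1.
by have := sqr_ge0 (a * sin th - b * cos th); lra.
Qed.

(** Orthogonal projection does not increase distances and sends the centre of a
    disc to the point of the corresponding word, so the projected gasket is
    contained in the shadow. *)
Lemma line_measure_gasket_le n th (l : R) : coverable (shadow (dir th) n) l ->
  (line_measure th (proj_line th @` gasket n) <= l%:E)%E.
Proof.
move=> cl; apply: le_trans (lebesgue_coverable cl).
apply: le_lebesgue => t [z [alpha ha hz]].
rewrite /proj_line => e.
have -> : t = dotc z (expi th).
  have ei : expi th != 0 :> R[i].
    apply/eqP => -[c0 s0]; have := cos2Dsin2 th.
    by rewrite c0 s0 expr0n addr0 => /eqP; rewrite eq_sym oner_eq0.
  by have /= := mulIf ei e => -[].
exists [seq digit (alpha k) | k <- enum 'I_n].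
  by apply: mem_words; rewrite size_map size_enum_ord.
rewrite -dotc_center; last by rewrite inE.
have -> : dotc z (expi th) - dotc (gasket_center alpha) (expi th) =
    dotc (z - gasket_center alpha) (expi th).
  by rewrite -{1}(subrK (gasket_center alpha) z) (dotcD (z - _)) addrK.
by apply: dotc_expi_le; exact: hz.
Qed.

(** On the exceptional set of angles the trivial bound 2 on the length of the
    shadow is used; the factor 2 / pi <= 1 absorbs it. *)
Lemma favard_gasket_le n (M l : R) (V : set R) :
  0 <= M -> measurable V -> (mu V <= l%:E)%E ->
  (forall th, 0 <= th <= pi -> ~ V th -> coverable (shadow (dir th) n) M) ->
  (favard (gasket n) <= (M + l)%:E :> \bar R)%E.
Proof.
move=> M0 mV Vl good; have p0 := pi_gt0 R.
have l0 : 0 <= l by rewrite -lee_fin; apply: le_trans Vl; exact: measure_ge0.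
apply: (@le_trans _ _ ((pi^-1)%:E *
    \int[mu]_(th in `[0%R, pi]) (M%:E + 2%:E * (\1_V th)%:E))%E).
  apply: lee_wpmul2l; first by rewrite lee_fin invr_ge0 ltW.
  apply: le_integral_of_le => th; first by move=> _; exact: measure_ge0.
  rewrite /= in_itv /= => ht; rewrite indicE.
  have [Vt|nVt] := boolP (th \in V).
    rewrite mule1; apply: le_trans (line_measure_gasket_le (coverable_shadow (dir_le1 th) n)) _.
    by rewrite -EFinD lee_fin lerDr.
  rewrite mule0 adde0; apply: line_measure_gasket_le; apply: good => //.
  by move/negP: nVt; rewrite inE.
rewrite ge0_integralD //; last first.
  apply: measurable_funeM; apply/measurable_EFinP; exact: measurable_indic.
rewrite integral_cst //= ge0_integralZl_EFin //; last first.
  by apply/measurable_EFinP; exact: measurable_indic.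
rewrite integral_indic // lebesgue_measure_itv /= lte_fin p0 -EFinD subr0.
have Vp : (mu (V `&` `[0%R, pi]) <= l%:E)%E.
  by apply: le_trans Vl; apply: le_lebesgue; exact: subIsetl.
apply: (@le_trans _ _ ((pi^-1)%:E * (M%:E * pi%:E + 2%:E * l%:E))%E).
  apply: lee_wpmul2l; first by rewrite lee_fin invr_ge0 ltW.
  by apply: leeD => //; apply: lee_wpmul2l.
rewrite -[leLHS]/((pi^-1 * (M * pi + 2 * l))%:E) lee_fin mulrDr mulrCA mulVf ?gt_eqF // mulr1 lerD2l.
rewrite mulrA ler_piMl // ler_pdivrMl // mulr1; exact: pi_ge2.
Qed.

Lemma favard_gasket_decay s n : (3 ^ (34 * s + 217) <= n)%N ->
  (favard (@gasket R n) <= (27 * 3 ^- s)%:E :> \bar R)%E.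
Proof.
move=> hn; have p3 := @pow3_gt0 R s.
have [V [V0 Vbad Vl]] := @coverable_bad_angles R (s + 5) _ erefl.
have -> : 27 * 3 ^- s = 26 * 3 ^- s + 3 ^- s :> R by ring.
apply: (@favard_gasket_le _ _ _ (ball_union V)).
- by rewrite mulr_ge0 // ltW.
- exact: measurable_ball_union.
- apply: le_trans (lebesgue_ball_union V0) _; rewrite lee_fin; apply: le_trans Vl _.
  by rewrite lef_pV2 ?posrE ?exprn_gt0 // ler_weXn2l ?ler1n // leq_addr.
move=> th ht nV; apply: good_angle_cover hn _ => u hu.
rewrite leNgt; apply/negP => h; apply: nV; apply: Vbad; split => //.
by exists u.
Qed.

Lemma favard_gasket_le2 n : (favard (@gasket R n) <= 2%:E :> \bar R)%E.
Proof.
rewrite -[2]addr0; apply: (@favard_gasket_le _ _ _ set0) => //; first by rewrite measure0.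
by move=> th _ _; exact: coverable_shadow (dir_le1 th) n.
Qed.

End Favard.

Theorem theorem1 (R : realType) :
  exists C c : R, 0 < C /\ 0 < c /\
    forall n : nat, (1 <= n)%N ->
      (favard (gasket n) <= (C / (n%:R `^ c))%:E :> \bar R)%E.
Proof.
(* With t the integer part of log_3 n / 217, n is at least 3^(217 t), so for
   t >= 1 the decay estimate applies with s = t - 1, while n^(1/217) is at most
   3^(t + 1).  For t = 0 the trivial bound 2 suffices. *)
exists 243, (217%:R^-1); split; first by rewrite ltr0n.
split; first by rewrite invr_gt0 ltr0n.
move=> n n1; set t := (trunc_log 3 n %/ 217)%N.
have n0 : 0 < n%:R :> R by rewrite ltr0n.
have root : n%:R `^ 217%:R^-1 <= 3 ^+ t.+1 :> R.
  have h : n%:R <= (3 ^+ t.+1) ^+ 217 :> R.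
    rewrite -exprM -natrX ler_nat; apply: (leq_trans (ltnW (trunc_log_ltn n _))) => //.
    rewrite leq_exp2l //; exact: ltn_ceil.
  have e (x : R) : 0 <= x -> (x ^+ 217) `^ 217%:R^-1 = x.
    by move=> x0; rewrite -powR_mulrn // -powRrM mulfV ?pnatr_eq0 // powRr1.
  rewrite -[leRHS]e ?exprn_ge0 //.
  by apply: ge0_ler_powR; rewrite ?nnegrE ?exprn_ge0 ?invr_ge0.
have q0 : 0 < n%:R `^ 217%:R^-1 :> R by exact: powR_gt0.
have bound : (favard (gasket n) <= (243 * 3 ^- t.+1)%:E :> \bar R)%E.
  case ts: t => [|s].
    apply: le_trans (favard_gasket_le2 n) _; rewrite lee_fin expr1; lra.
  apply: le_trans (@favard_gasket_decay R s n _) _.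
    apply: (@leq_trans (3 ^ trunc_log 3 n)); last exact: trunc_logP.
    rewrite leq_exp2l //; apply: leq_trans (leq_trunc_div _ 217); rewrite -/t ts; lia.
  by rewrite lee_fin !exprS !invfM; have := @pow3_gt0 R s; lra.
apply: le_trans bound _; rewrite lee_fin; apply: (ler_wpM2l (ler0n R 243)).
by rewrite lef_pV2 ?posrE ?exprn_gt0.
Qed.
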